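(* For every nearby $\mathbb D$-valued three-form $\varphi$ whose reduction $\varphi^{[0]}$ is positive, $$W_{\rm ext}=\frac14\int_Ye^{-2\Phi}\Bigl(H\wedge\psi-\frac12\,d\varphi\wedge\varphi\Bigr),$$ where $W_{\rm ext}=\int_Y\bigl[\beta_\Delta(\zeta,D_g\zeta)+\frac14\beta_\Delta(\zeta,H\cdot\zeta)\bigr]\mathrm{vol}_g$ with $\zeta=e^{-\Phi}\chi$.
   Context: $Y$ is a spin $7$-manifold, $\mathbb D=\mathbb R[\epsilon]/(\epsilon^2)$; smooth pointwise constructions extend to $\mathbb D$-valued fields by first-order Taylor expansion. $\varphi$ determines $g$ and orientation by $\frac16(\iota_v\varphi)\wedge(\iota_w\varphi)\wedge\varphi=g(v,w)\mathrm{vol}_g$, $\psi=*_g\varphi$, and a unit real spinor $\chi$ (up to sign) with $\varphi(X,Y,Z)=\beta_\Delta(\chi,(X^\flat\wedge Y^\flat\wedge Z^\flat)\cdot\chi)$ and $\psi(X,Y,Z,W)=-\beta_\Delta(\chi,(X^\flat\wedge Y^\flat\wedge Z^\flat\wedge W^\flat)\cdot\chi)$. $\beta_\Delta$ is the symmetric invariant pairing on real spinors; Clifford multiplication satisfies $c_g(X)c_g(Y)+c_g(Y)c_g(X)=-2g(X,Y)$, extended to forms by antisymmetrized products (so a three-form acts as $\frac16H_{abc}\gamma^{abc}$), and $\alpha\cdot\chi=c_g(\alpha)\chi$. $D_g$ is the Levi-Civita Dirac operator. $\Phi$ is a $\mathbb D$-valued function (dilaton) and $H$ the $\mathbb D$-valued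 three-form flux. *)

(* Defs.v *)
From HB Require Import structures.
From mathcomp Require Import all_boot all_order all_algebra all_fingroup.
From mathcomp Require Import all_classical all_reals all_analysis.
From mathcomp Require Import ring.

Set Implicit Arguments.
Unset Strict Implicit.
Unset Printing Implicit Defensive.

Import Order.TTheory GRing.Theory Num.Theory.
Import numFieldNormedType.Exports.

Local Open Scope classical_set_scope.
Local Open Scope ring_scope.

(** * Dual numbers: [Dual a b] is a + b eps in K[eps]/(eps^2) *)

Record dual (K : Type) := Dual { dre : K; deps : K }.

Definition pair_of_dual (K : Type) (x : dual K) : K * K := (dre x, deps x).
Definition dual_of_pair (K : Type) (p : K * K) : dual K := Dual p.1 p.2.
Lemma pair_of_dualK (K : Type) : cancel (@pair_of_dual K) (@dual_of_pair K).
Proof. by case. Qed.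

HB.instance Definition _ (K : choiceType) :=
  Choice.copy (dual K) (can_type (@pair_of_dualK K)).

Section DualRing.
Variable K : fieldType.
Implicit Types x y z : dual K.

Lemma dual_eq x y : dre x = dre y -> deps x = deps y -> x = y.
Proof. by case: x y => a b [c d] /= -> ->. Qed.

Definition dual_zero : dual K := Dual 0 0.
Definition dual_opp x : dual K := Dual (- dre x) (- deps x).
Definition dual_add x y : dual K := Dual (dre x + dre y) (deps x + deps y).

Lemma dual_addA : associative dual_add.
Proof. by move=> x y z; apply: dual_eq; rewrite /= addrA. Qed.
Lemma dual_addC : commutative dual_add.
Proof. by move=> x y; apply: dual_eq; rewrite /= addrC. Qed.
Lemma dual_add0 : left_id dual_zero dual_add.
Proof. by move=> x; apply: dual_eq; rewrite /= add0r. Qed.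
Lemma dual_addN : left_inverse dual_zero dual_opp dual_add.
Proof. by move=> x; apply: dual_eq; rewrite /= addNr. Qed.

HB.instance Definition _ := GRing.isZmodule.Build (dual K)
  dual_addA dual_addC dual_add0 dual_addN.

Definition dual_one : dual K := Dual 1 0.
Definition dual_mul x y : dual K :=
  Dual (dre x * dre y) (dre x * deps y + deps x * dre y).

Lemma dual_mulA : associative dual_mul.
Proof. by move=> x y z; apply: dual_eq => /=; ring. Qed.
Lemma dual_mulC : commutative dual_mul.
Proof. by move=> x y; apply: dual_eq => /=; ring. Qed.
Lemma dual_mul1 : left_id dual_one dual_mul.
Proof. by move=> x; apply: dual_eq => /=; ring. Qed.
Lemma dual_mulDl : left_distributive dual_mul +%R.
Proof. by move=> x y z; apply: dual_eq => /=; ring. Qed.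
Lemma dual_one_neq0 : dual_one != 0.
Proof. by apply/eqP => -[] /eqP; rewrite oner_eq0. Qed.

HB.instance Definition _ := GRing.Zmodule_isComNzRing.Build (dual K)
  dual_mulA dual_mulC dual_mul1 dual_mulDl dual_one_neq0.

Definition dual_unit : pred (dual K) := fun x => dre x != 0.
Definition dual_inv x : dual K :=
  if dual_unit x then Dual (dre x)^-1 (- (deps x / dre x ^+ 2)) else x.

Lemma dual_mulV : {in dual_unit, left_inverse 1 dual_inv *%R}.
Proof.
move=> x ux; have nz : dre x != 0 by [].
by rewrite /dual_inv /dual_unit nz; apply: dual_eq => /=; field.
Qed.
Lemma dual_unitP x y : y * x = 1 -> dual_unit x.
Proof.
case=> yx1 _; apply/eqP => x0; move/eqP: yx1.
by rewrite x0 mulr0 eq_sym oner_eq0.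
Qed.
Lemma dual_inv_out : {in [predC dual_unit], dual_inv =1 id}.
Proof.
by move=> x nx; rewrite /dual_inv; have -> : dual_unit x = false by exact/negbTE.
Qed.

HB.instance Definition _ := GRing.ComNzRing_hasMulInverse.Build (dual K)
  dual_mulV dual_unitP dual_inv_out.

Definition dual_const (a : K) : dual K := Dual a 0.

End DualRing.

(** * Multilinear algebra in seven variables *)

(* A k-form on A^7 is given by its components on the coordinate vectors,
   i.e. f |-> alpha(e_(f 0), ..., e_(f (k-1))).  Interior products, wedge
   products and stars use the determinant convention, so that
   dx^1 /\ ... /\ dx^k has value 1 on (e_1, ..., e_k). *)
Section Forms.
Variable A : comUnitRingType.

Definition kform (k : nat) := ('I_k -> 'I_7) -> A.

Definition alternating (k : nat) (alpha : kform k) :=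
  forall (s : 'S_k) (f : 'I_k -> 'I_7),
    alpha (f \o s) = (-1) ^+ odd_perm s * alpha f.

Definition wedge (k l : nat) (alpha : kform k) (beta : kform l) :
    kform (k + l) := fun f =>
  (k`!)%:R^-1 * (l`!)%:R^-1 *
  \sum_(s : 'S_(k + l)) (-1) ^+ odd_perm s *
     alpha (fun i => f (s (lshift l i))) * beta (fun j => f (s (rshift k j))).

Definition interior (k : nat) (v : 'rV[A]_7) (alpha : kform k.+1) : kform k :=
  fun f => \sum_(a < 7) v 0 a * alpha (fun m => oapp f a (unlift ord0 m)).

Definition form_eval (k : nat) (alpha : kform k) (X : 'I_k -> 'rV[A]_7) : A :=
  \sum_(f : {ffun 'I_k -> 'I_7}) (\prod_m X m 0 (f m)) * alpha f.

(* Components of alpha on the vectors given by the rows of E. *)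
Definition form_pull (k : nat) (E : 'M[A]_7) (alpha : kform k) : kform k :=
  fun f => form_eval alpha (fun m => row (f m) E).

(* The coefficient of dx^1 /\ ... /\ dx^7. *)
Definition top_coef (omega : kform 7) : A := omega id.

Definition gpair (G : 'M[A]_7) (v w : 'rV[A]_7) : A := (v *m G *m w^T) 0 0.

Definition flat (G : 'M[A]_7) (v : 'rV[A]_7) : kform 1 :=
  fun f => (v *m G) 0 (f ord0).

Definition levi_civita (f : 'I_7 -> 'I_7) : A :=
  \det (\matrix_(a < 7, b < 7) (f a == b)%:R).

(* The Hodge star on three-forms for the metric G and the volume form
   s dx^1 /\ ... /\ dx^7; indices are raised by pulling back along G^-1. *)
Definition hodge3 (G : 'M[A]_7) (s : A) (alpha : kform 3) : kform 4 :=
  fun g => s * (3`!)%:R^-1 *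
    \sum_(f : {ffun 'I_3 -> 'I_7})
       form_pull (invmx G) alpha f *
       levi_civita (fun m => match @fintype.split 3 4 m with
                             | inl a => f a
                             | inr b => g b
                             end).

(* The Lambda^7-valued form (v, w) |-> i_v phi /\ i_w phi /\ phi. *)
Definition phi_pairing (phi : kform 3) (v w : 'rV[A]_7) : A :=
  top_coef (wedge (wedge (interior v phi) (interior w phi)) phi).

End Forms.

(** * Smooth 7-manifolds *)

Section Manifold.
Variable R : realType.

(* C^infinity: all iterated partial derivatives are differentiable. *)
Definition smooth_on (V : set 'rV[R]_7) (h : 'rV[R]_7 -> R) :=
  forall (l : seq 'I_7) (x : 'rV[R]_7), V x ->
    differentiable
      (foldr (fun a (u : 'rV[R]_7 -> R) x' => 'D_(delta_mx 0 a) u x') h l) x.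

Record manifold7 (Y : topologicalType) := Manifold7 {
  chart : Type;
  dom : chart -> set Y;
  coord : chart -> Y -> 'rV[R]_7;
  param : chart -> 'rV[R]_7 -> Y;
  manifold_hausdorff : hausdorff_space Y;
  manifold_second_countable : @second_countable Y;
  dom_open : forall i, open (dom i);
  dom_cover : forall y, exists i, dom i y;
  image_open : forall i, open (coord i @` dom i);
  coordK : forall i y, dom i y -> param i (coord i y) = y;
  coord_continuous : forall i y, dom i y -> {for y, continuous (coord i)};
  param_continuous : forall i x, (coord i @` dom i) x ->
    {for x, continuous (param i)};
  transition_smooth : forall i j a,
    smooth_on (coord i @` (dom i `&` dom j)) (fun x => coord j (param i x) 0 a)
}.

Variables (Y : topologicalType) (M : manifold7 Y).

Notation D := (dual R).

Definition smooth_real (U : set Y) (f : Y -> R) :=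
  forall i : chart M, smooth_on (coord i @` (dom i `&` U)) (f \o param i).

Definition smooth_dual (U : set Y) (f : Y -> D) :=
  smooth_real U (@dre R \o f) /\ smooth_real U (@deps R \o f).

Definition partial_real (i : chart M) (a : 'I_7) (f : Y -> R) (y : Y) : R :=
  'D_(delta_mx 0 a) (f \o param i) (coord i y).

Definition partial_dual (i : chart M) (a : 'I_7) (f : Y -> D) (y : Y) : D :=
  Dual (partial_real i a (@dre R \o f) y) (partial_real i a (@deps R \o f) y).

(* Entry (a, b) is the derivative of x_j^b along x_i^a. *)
Definition jacobian (i j : chart M) (y : Y) : 'M[D]_7 :=
  \matrix_(a, b) dual_const (partial_real i a (fun z => coord j z 0 b) y).

(* A D-valued k-form field is given by its components in each chart; only the
   values over the domain of the chart are meaningful. *)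
Definition form_field (k : nat) := chart M -> Y -> kform D k.

Definition is_form_field (k : nat) (alpha : form_field k) :=
  [/\ forall i y, dom i y -> alternating (alpha i y),
      forall i f, smooth_dual (dom i) (fun y => alpha i y f) &
      forall i j y f, dom i y -> dom j y ->
        alpha i y f = form_pull (jacobian i j y) (alpha j y) f].

Definition ext_deriv (k : nat) (alpha : form_field k) : form_field k.+1 :=
  fun i y f => \sum_(j < k.+1) (-1) ^+ j *
    partial_dual i (f j) (fun z => alpha i z (fun m : 'I_k => f (lift j m))) y.

(* Extension of the real exponential by first-order Taylor expansion. *)
Definition dual_exp (x : D) : D :=
  Dual (expR (dre x)) (expR (dre x) * deps x).

(** * Positive three-forms, and the metric and volume form they determine *)

(* phi^[0] is positive when i_v phi^[0] /\ i_v phi^[0] /\ phi^[0] is nonzero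
   for every nonzero v; no orientation is prescribed in advance. *)
Definition positive_reduction (phi : form_field 3) :=
  forall i y (v : 'rV[R]_7), dom i y -> v != 0 ->
    phi_pairing (fun f => dre (phi i y f)) v v != 0.

(* In the chart i the metric is G i y and its volume form is
   s i y dx^1 /\ ... /\ dx^7.  The sign of s is that of the chart relative to
   the orientation determined by phi.  Over a positive reduction these
   equations have exactly one D-valued solution, whose eps-part is the first
   variation of the real solution: this is its Taylor extension. *)
Definition determines_metric (phi : form_field 3)
    (G : chart M -> Y -> 'M[D]_7) (s : chart M -> Y -> D) :=
  [/\ forall i a b, smooth_dual (dom i) (fun y => G i y a b),
      forall i, smooth_dual (dom i) (s i) &
      forall i y, dom i y ->
      [/\ (G i y)^T = G i y,
          forall v : 'rV[R]_7, v != 0 ->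
            0 < gpair (map_mx (@dre R) (G i y)) v v,
          (s i y) ^+ 2 = \det (G i y) &
          forall v w : 'rV[D]_7,
            6%:R^-1 * phi_pairing (phi i y) v w = gpair (G i y) v w * s i y]].

(** * Spinors *)

(* A real Clifford module of dimension 8 (one of the two irreducible ones).
   Invariance is stated for the unit vectors of an orthonormal basis, hence
   holds for Spin(7); equivalently vectors act by skew operators. *)
Record spinor_module := SpinorModule {
  gamma : 'I_7 -> 'M[R]_8;
  pairing : 'M[R]_8;
  gamma_clifford : forall a b,
    gamma a *m gamma b + gamma b *m gamma a = (- 2%:R * (a == b)%:R)%:M;
  pairing_sym : pairing^T = pairing;
  pairing_invariant : forall a, (gamma a)^T *m pairing *m gamma a = pairing
}.

Variable S : spinor_module.

Definition dgamma (a : 'I_7) : 'M[D]_8 := map_mx (@dual_const R) (gamma S a).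

Definition spinor_pair (x z : 'cV[D]_8) : D :=
  (x^T *m map_mx (@dual_const R) (pairing S) *m z) 0 0.

Definition gamma_alt (k : nat) (f : 'I_k -> 'I_7) : 'M[D]_8 :=
  (k`!)%:R^-1 *:
    \sum_(t : 'S_k) (-1) ^+ odd_perm t *: \prod_(m < k) dgamma (f (t m)).

(* Clifford action of a form with components alpha in a coordinate basis,
   the orthonormal frame being given by the rows of E. *)
Definition clifford (k : nat) (E : 'M[D]_7) (alpha : kform D k) : 'M[D]_8 :=
  (k`!)%:R^-1 *:
    \sum_(f : {ffun 'I_k -> 'I_7}) form_pull E alpha f *: gamma_alt f.

(* A spin structure on (Y, g): local oriented g-orthonormal frames, with the
   rows of [frame p i y] the components of the frame in the chart i, together
   with a cocycle lifting their transition functions.  A matrix u preserving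
   the pairing and inducing a rotation of the gammas by conjugation is exactly
   an element of Spin(7) acting on the spinor module. *)
Record spin_structure (G : chart M -> Y -> 'M[D]_7) (s : chart M -> Y -> D) :=
SpinStructure {
  spin_patch : Type;
  pdom : spin_patch -> set Y;
  frame : spin_patch -> chart M -> Y -> 'M[D]_7;
  spin_lift : spin_patch -> spin_patch -> Y -> 'M[D]_8;
  pdom_open : forall p, open (pdom p);
  pdom_cover : forall y, exists p, pdom p y;
  frame_smooth : forall p i a b,
    smooth_dual (pdom p `&` dom i) (fun y => frame p i y a b);
  frame_transform : forall p i j y, pdom p y -> dom i y -> dom j y ->
    frame p j y = frame p i y *m jacobian i j y;
  frame_orthonormal : forall p i y, pdom p y -> dom i y ->
    frame p i y *m G i y *m (frame p i y)^T = 1%:M;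
  frame_oriented : forall p i y, pdom p y -> dom i y ->
    s i y * \det (frame p i y) = 1;
  lift_smooth : forall p q m n,
    smooth_dual (pdom p `&` pdom q) (fun y => spin_lift p q y m n);
  lift_gamma : forall p q i y b, pdom p y -> pdom q y -> dom i y ->
    spin_lift p q y *m dgamma b =
      (\sum_a (frame p i y *m G i y *m (frame q i y)^T) a b *: dgamma a)
        *m spin_lift p q y;
  lift_pairing : forall p q y, pdom p y -> pdom q y ->
    (spin_lift p q y)^T *m map_mx (@dual_const R) (pairing S)
      *m spin_lift p q y = map_mx (@dual_const R) (pairing S);
  lift_cocycle : forall p q r y, pdom p y -> pdom q y -> pdom r y ->
    spin_lift p q y *m spin_lift q r y = spin_lift p r y
}.

Variables (G : chart M -> Y -> 'M[D]_7) (s : chart M -> Y -> D).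
Variable P : spin_structure G s.

Definition spinor_field := spin_patch P -> Y -> 'cV[D]_8.

(* A spinor defined up to sign: local representatives agree up to sign, so
   every quantity quadratic in it is globally defined. *)
Definition is_spinor_up_to_sign (chi : spinor_field) :=
  (forall p m, smooth_dual (pdom p) (fun y => chi p y m 0)) /\
  (forall p q y, pdom p y -> pdom q y ->
     chi p y = spin_lift p q y *m chi q y \/
     chi p y = - (spin_lift p q y *m chi q y)).

(* The unit spinor attached to phi and psi. *)
Definition determines_spinor (phi : form_field 3) (psi : form_field 4)
    (chi : spinor_field) :=
  is_spinor_up_to_sign chi /\
  forall p i y, pdom p y -> dom i y ->
    let E := frame p i y in
    let fl := flat (G i y) in
    [/\ spinor_pair (chi p y) (chi p y) = 1,
        forall X Z T : 'rV[D]_7,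
          form_eval (phi i y) (tnth [tuple X; Z; T]) =
          spinor_pair (chi p y)
            (clifford E (wedge (wedge (fl X) (fl Z)) (fl T)) *m chi p y) &
        forall X Z T V : 'rV[D]_7,
          form_eval (psi i y) (tnth [tuple X; Z; T; V]) =
          - spinor_pair (chi p y)
            (clifford E (wedge (wedge (wedge (fl X) (fl Z)) (fl T)) (fl V))
               *m chi p y)].

(** * The Levi-Civita Dirac operator *)

(* Gamma^k_(ab) *)
Definition christoffel (i : chart M) (y : Y) (k a b : 'I_7) : D :=
  2%:R^-1 * \sum_l invmx (G i y) k l *
    (partial_dual i a (fun z => G i z b l) y
     + partial_dual i b (fun z => G i z a l) y
     - partial_dual i l (fun z => G i z a b) y).

(* nabla_a e_b, in the coordinate basis *)
Definition nabla_frame (p : spin_patch P) (i : chart M) (y : Y) (a b : 'I_7) :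
    'rV[D]_7 :=
  \row_k (partial_dual i a (fun z => frame p i z b k) y
          + \sum_j christoffel i y k a j * frame p i y b j).

(* The sign of the connection term is the one for which Clifford
   multiplication with gamma^2 = -1 is parallel. *)
Definition nabla_spinor (p : spin_patch P) (i : chart M) (a : 'I_7)
    (zeta : Y -> 'cV[D]_8) (y : Y) : 'cV[D]_8 :=
  \col_m partial_dual i a (fun z => zeta z m 0) y
  + (4%:R^-1 *: \sum_b \sum_c
       gpair (G i y) (nabla_frame p i y a b) (row c (frame p i y))
         *: (dgamma b *m dgamma c)) *m zeta y.

Definition dirac (p : spin_patch P) (i : chart M) (zeta : Y -> 'cV[D]_8)
    (y : Y) : 'cV[D]_8 :=
  \sum_b \sum_a
    frame p i y b a *: (dgamma b *m nabla_spinor p i a zeta y).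

(** * Integration *)

(* The integral over R^n, as an iterated Lebesgue integral; it is applied
   below to compactly supported functions. *)
Fixpoint iterated_integral (n : nat) : ('rV[R]_n -> R) -> R :=
  match n with
  | 0 => fun f => f 0
  | n'.+1 => fun f =>
      Rintegral (@lebesgue_measure R) setT
        (fun t : R => iterated_integral
           (fun x : 'rV[R]_n' => f (row_mx (const_mx t : 'rV[R]_1) x)))
  end.

Record partition_of_unity := PartitionOfUnity {
  rho : nat -> Y -> R;
  pchart : nat -> chart M;
  rho_smooth : forall n, smooth_real setT (rho n);
  rho_ge0 : forall n y, 0 <= rho n y;
  rho_support : forall n, exists K : set Y,
    [/\ compact K, K `<=` dom (pchart n) & forall y, ~ K y -> rho n y = 0];
  rho_locally_finite : forall y, exists U : set Y,
    [/\ open U, U y &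
        exists n0, forall n z, (n0 <= n)%N -> U z -> rho n z = 0];
  rho_sum1 : forall y, (fun n => \sum_(k < n) rho k y) @ \oo --> (1 : R)
}.

Variable rh : partition_of_unity.

(* The contribution of the n-th chart, with [w] the coefficient of
   dx^1 /\ ... /\ dx^7; the sign of s compares the orientation of the chart
   with the one determined by phi. *)
Definition chart_integral (n : nat) (w : Y -> R) : R :=
  let i := pchart rh n in
  iterated_integral
    ((fun x => let y := param i x in rho rh n y * Num.sg (dre (s i y)) * w y)
       \_ (coord i @` dom i)).

(* The integral of a D-valued 7-form, taken componentwise. *)
Definition integral7 (w : chart M -> Y -> D) : D :=
  Dual (limn (series (fun n => chart_integral n (@dre R \o w (pchart rh n)))))
       (limn (series (fun n => chart_integral n (@deps R \o w (pchart rh n))))).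

(** * The functional *)

(* The density beta(z, D z) + 1/4 beta(z, H.z) at y does not depend on the
   patch around y; one is chosen by [pdom_cover]. *)
Definition patch_at (y : Y) : spin_patch P := sval (cid (pdom_cover P y)).

Definition ext_density (H : form_field 3) (zeta : spinor_field)
    (i : chart M) (y : Y) : D :=
  let p := patch_at y in
  spinor_pair (zeta p y) (dirac p i (zeta p) y)
  + 4%:R^-1 *
    spinor_pair (zeta p y) (clifford (frame p i y) (H i y) *m zeta p y).

Definition Wext (Phi : Y -> D) (H : form_field 3) (chi : spinor_field) : D :=
  let zeta : spinor_field := fun p y => dual_exp (- Phi y) *: chi p y in
  integral7 (fun i y => ext_density H zeta i y * s i y).

End Manifold.

(* Main.v *)
(** At a point everything is expressed in the orthonormal frame of the spin
structure.  There phi_abc = <chi, gamma_a gamma_b gamma_c chi>, and psi_abcd is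
minus the antisymmetrised four-gamma bilinear; hence H /\ psi = <chi, H.chi> vol.
For d phi /\ phi = <d phi, psi> vol one differentiates the formula for phi: the
Christoffel symbols cancel by symmetry, the spin connection turns d chi into the
covariant derivative, and there remains
4 psi^mbcd <nabla_m chi, gamma_b gamma_c gamma_d chi>.  Since
chi, gamma_1 chi, ..., gamma_7 chi is an orthonormal basis of the spinors,
psi_mbcd gamma_b gamma_c gamma_d chi = 24 gamma_m chi, so
d phi /\ phi = - 8 <chi, D chi> vol.  Finally <chi, gamma_a chi> = 0, so the
derivative of the dilaton drops out of <zeta, D zeta>. *)

From HB Require Import structures.
From mathcomp Require Import all_boot all_order all_algebra all_fingroup.
From mathcomp Require Import all_classical all_reals all_analysis.
From mathcomp Require Import ring.
Require Import Defs.

Set Implicit Arguments.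
Unset Strict Implicit.
Unset Printing Implicit Defensive.

Import Order.TTheory GRing.Theory Num.Theory.
Import numFieldNormedType.Exports.

Local Open Scope classical_set_scope.
Local Open Scope ring_scope.

(** * Wedge products and the Hodge star in terms of the permutation symbol *)

(** The algebra is done over an arbitrary commutative ring in which the positive integers are units.
    Dual numbers form such a ring but have zero divisors, so dimension counts and division by
    nonzero scalars are replaced by two devices: cancelling an integer, and the fact that a left
    inverse of a square matrix is also a right inverse. Derivatives enter the algebra as separate
    matrices and vectors, tied to the fields only by the differentiated identities; the analysis
    then has to supply just these identities at one point, for an arbitrary spin patch around it.
    The form [psi] is used in two ways, as the star of [phi] and as a four-gamma bilinear; passing
    from one to the other turns a wedge with [phi] into a contraction that the Clifford algebra can
    evaluate. The integrals come with no statement of integrability or convergence, so additivity is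
    avoided: the two densities agree at every point up to the constant 1/4, and a positive real
    constant passes through the integrals and limits even where these take default values. *)

Definition fcat (k l : nat) (f : 'I_k -> 'I_7) (g : 'I_l -> 'I_7) :
    'I_(k + l) -> 'I_7 :=
  fun m => match @fintype.split k l m with inl a => f a | inr b => g b end.

Lemma fcat_lshift k l (f : 'I_k -> 'I_7) (g : 'I_l -> 'I_7) i :
  fcat f g (lshift l i) = f i.
Proof. by rewrite /fcat (unsplitK (inl i)). Qed.

Lemma fcat_rshift k l (f : 'I_k -> 'I_7) (g : 'I_l -> 'I_7) j :
  fcat f g (rshift k j) = g j.
Proof. by rewrite /fcat (unsplitK (inr j)). Qed.

Lemma fcat_eta k l (h : 'I_(k + l) -> 'I_7) :
  fcat (fun i => h (lshift l i)) (fun j => h (rshift k j)) = h.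
Proof.
by apply/funext => m; case: (split_ordP m) => ? ->;
  rewrite ?fcat_lshift ?fcat_rshift.
Qed.

Lemma comp_fcat k l (s : 'I_7 -> 'I_7) (f : 'I_k -> 'I_7) (g : 'I_l -> 'I_7) :
  s \o fcat f g = fcat (s \o f) (s \o g).
Proof.
by apply/funext => m /=; case: (split_ordP m) => ? ->;
  rewrite ?fcat_lshift ?fcat_rshift.
Qed.

Section Forms.
Variable A : comUnitRingType.
Implicit Types E G : 'M[A]_7.

Lemma ffun_eta (I J : finType) (f : I -> J) : finfun f = f :> (I -> J).
Proof. by apply/funext => i; rewrite ffunE. Qed.

Lemma sum_fcat k l (X : ('I_(k + l) -> 'I_7) -> A) :
  \sum_(h : {ffun 'I_(k + l) -> 'I_7}) X h =
  \sum_(f : {ffun 'I_k -> 'I_7}) \sum_(g : {ffun 'I_l -> 'I_7}) X (fcat f g).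
Proof.
rewrite pair_bigA /=.
rewrite (reindex (fun p : {ffun 'I_k -> 'I_7} * {ffun 'I_l -> 'I_7} =>
  finfun (fcat p.1 p.2))) /=; first by apply: eq_bigr => p _; rewrite ffun_eta.
exists (fun h : {ffun 'I_(k + l) -> 'I_7} =>
  ([ffun i => h (lshift l i)], [ffun j => h (rshift k j)])) => [[f g]|h] _ /=.
  by congr pair; apply/ffunP => i; rewrite !ffunE ?fcat_lshift ?fcat_rshift.
by apply/ffunP => m; rewrite ffunE !ffun_eta fcat_eta.
Qed.

(** Leibniz expansion of the determinant behind [levi_civita A g]: the term of a permutation [s]
    vanishes unless [g] is [s]. This trades the permutation sum of [wedge] for sums over independent
    indices. *)
Lemma sum_perm_levi_civita (X : ('I_7 -> 'I_7) -> A) :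
  \sum_(s : 'S_7) (-1) ^+ odd_perm s * X s =
  \sum_(g : {ffun 'I_7 -> 'I_7}) levi_civita A g * X g.
Proof.
transitivity (\sum_(g : {ffun 'I_7 -> 'I_7}) \sum_(s : 'S_7)
    (-1) ^+ odd_perm s * ((g == finfun s)%:R * X g)); last first.
  apply: eq_bigr => g _; rewrite /levi_civita /determinant mulr_suml.
  apply: eq_bigr => s _; rewrite -mulrA; congr (_ * (_ * _)).
  have [->|/eqP ne] := eqVneq g (finfun s).
    by rewrite big1 // => a _; rewrite mxE ffunE eqxx.
  have /existsP[a ga] : [exists a, g a != s a].
    apply/existsP; apply: contrapT => eqg; apply: ne; apply/ffunP => a.
    by rewrite ffunE; apply/eqP; apply: contrapT => ga; apply: eqg; exists a; apply/negP.
  by rewrite (bigD1 a) //= mxE (negbTE ga) mul0r.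
rewrite exchange_big /=; apply: eq_bigr => s _.
rewrite -mulr_sumr (bigD1 (finfun s)) //= eqxx mul1r ffun_eta.
by rewrite big1 ?addr0 // => g /negbTE ->; rewrite mul0r.
Qed.

Lemma levi_civitaE (f : 'I_7 -> 'I_7) : levi_civita A f = \det (rowsub f 1%:M).
Proof. by congr (\det _); apply/matrixP => a b; rewrite !mxE. Qed.

Lemma levi_civita_comp_perm (s : 'S_7) (f : 'I_7 -> 'I_7) :
  levi_civita A (s \o f) = (-1) ^+ odd_perm s * levi_civita A f.
Proof.
rewrite mulrC !levi_civitaE -det_perm -det_mulmx mul_rowsub_mx mul1mx.
by congr (\det _); apply/matrixP => a b; rewrite !mxE.
Qed.

Lemma levi_civita_perm_comp (s : 'S_7) (f : 'I_7 -> 'I_7) :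
  levi_civita A (f \o s) = (-1) ^+ odd_perm s * levi_civita A f.
Proof.
rewrite !levi_civitaE -det_perm -det_mulmx perm_mxEsub mul_rowsub_mx mul1mx.
by congr (\det _); apply/matrixP => a b; rewrite !mxE.
Qed.

(** The left side is the Leibniz formula for the matrix whose rows are the rows of [E] selected by
    [k]; its determinant factors. *)
Lemma sum_levi_civita_mx E (k : 'I_7 -> 'I_7) :
  \sum_(g : {ffun 'I_7 -> 'I_7}) levi_civita A g * \prod_m E (k m) (g m) =
  \det E * levi_civita A k.
Proof.
rewrite -(sum_perm_levi_civita (fun g => \prod_m E (k m) (g m))).
rewrite levi_civitaE mulrC -det_mulmx mul_rowsub_mx mul1mx.
by apply: eq_bigr => s _; congr (_ * _); apply: eq_bigr => a _; rewrite mxE.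
Qed.

Lemma form_pullE k E (alpha : kform A k) f :
  form_pull E alpha f =
  \sum_(h : {ffun 'I_k -> 'I_7}) (\prod_m E (f m) (h m)) * alpha h.
Proof.
by apply: eq_bigr => h _; congr (_ * _); apply: eq_bigr => m _; rewrite mxE.
Qed.

Lemma form_pull_mul k E1 E2 (alpha : kform A k) f :
  form_pull (E1 *m E2) alpha f = form_pull E1 (form_pull E2 alpha) f.
Proof.
rewrite !form_pullE; under [RHS]eq_bigr do rewrite form_pullE mulr_sumr.
rewrite exchange_big /=; apply: eq_bigr => h _.
under [RHS]eq_bigr do rewrite mulrA -big_split /=.
rewrite -mulr_suml; congr (_ * _).
by under eq_bigr do rewrite mxE; rewrite bigA_distr_bigA.
Qed.

Lemma prod_fcat k l E (f g : 'I_k -> 'I_7) (f' g' : 'I_l -> 'I_7) :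
  \prod_m E (fcat f f' m) (fcat g g' m) =
  (\prod_m E (f m) (g m)) * (\prod_m E (f' m) (g' m)).
Proof.
rewrite big_split_ord /=; congr (_ * _); apply: eq_bigr => m _;
by rewrite ?fcat_lshift ?fcat_rshift.
Qed.

Lemma wedge_fcat k l (alpha : kform A k) (beta : kform A l) f g :
  alpha (fun i => fcat f g (lshift l i)) * beta (fun j => fcat f g (rshift k j))
  = alpha f * beta g.
Proof.
by congr (alpha _ * beta _); apply/funext => i;
  rewrite ?fcat_lshift ?fcat_rshift.
Qed.

Lemma top_wedge34 (alpha : kform A 3) (beta : kform A 4) :
  top_coef (wedge alpha beta) = (3`!)%:R^-1 * (4`!)%:R^-1 *
    \sum_(f : {ffun 'I_3 -> 'I_7}) \sum_(g : {ffun 'I_4 -> 'I_7})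
      levi_civita A (@fcat 3 4 f g) * (alpha f * beta g).
Proof.
rewrite /top_coef /wedge; congr (_ * _).
under eq_bigr do rewrite -mulrA.
rewrite (sum_perm_levi_civita (fun h =>
  alpha (fun i => h (lshift 4 i)) * beta (fun j => h (rshift 3 j)))).
rewrite (@sum_fcat 3 4 (fun h => levi_civita A h *
  (alpha (fun i => h (lshift 4 i)) * beta (fun j => h (rshift 3 j))))).
by apply: eq_bigr => f _; apply: eq_bigr => g _; rewrite wedge_fcat.
Qed.

Lemma top_wedge43 (alpha : kform A 4) (beta : kform A 3) :
  top_coef (wedge alpha beta) = (4`!)%:R^-1 * (3`!)%:R^-1 *
    \sum_(f : {ffun 'I_4 -> 'I_7}) \sum_(g : {ffun 'I_3 -> 'I_7})
      levi_civita A (@fcat 4 3 f g) * (alpha f * beta g).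
Proof.
rewrite /top_coef /wedge; congr (_ * _).
under eq_bigr do rewrite -mulrA.
rewrite (sum_perm_levi_civita (fun h =>
  alpha (fun i => h (lshift 3 i)) * beta (fun j => h (rshift 4 j)))).
rewrite (@sum_fcat 4 3 (fun h => levi_civita A h *
  (alpha (fun i => h (lshift 3 i)) * beta (fun j => h (rshift 4 j))))).
by apply: eq_bigr => f _; apply: eq_bigr => g _; rewrite wedge_fcat.
Qed.

Lemma sum_levi_civita_mx_tr E (k : 'I_7 -> 'I_7) :
  \sum_(g : {ffun 'I_7 -> 'I_7}) levi_civita A g * \prod_m E (g m) (k m) =
  \det E * levi_civita A k.
Proof.
rewrite -det_tr -sum_levi_civita_mx.
by apply: eq_bigr => g _; congr (_ * _); apply: eq_bigr => m _; rewrite mxE.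
Qed.

(** Only the transformation law of the symbol under [E] matters, so [eps] and [c] stay abstract;
    they become [levi_civita] and the determinant of [E] for both splittings of seven indices. *)
Lemma sum_fcat_pull k l E (c : A) (eps : ('I_(k + l) -> 'I_7) -> A)
    (alpha : kform A k) (beta : kform A l) :
  (forall h, \sum_(g : {ffun 'I_(k + l) -> 'I_7})
     eps g * \prod_m E (g m) (h m) = c * eps h) ->
  \sum_(f : {ffun 'I_k -> 'I_7}) \sum_(g : {ffun 'I_l -> 'I_7})
    eps (fcat f g) * (form_pull E alpha f * form_pull E beta g) =
  c * \sum_(f : {ffun 'I_k -> 'I_7}) \sum_(g : {ffun 'I_l -> 'I_7})
    eps (fcat f g) * (alpha f * beta g).
Proof.
move=> eps_pull; under eq_bigr do under eq_bigr do
  rewrite !form_pullE big_distrlr /= pair_bigA mulr_sumr /=.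
rewrite pair_bigA exchange_big /= [in RHS]pair_bigA mulr_sumr /=.
apply: eq_bigr => -[f' g'] _ /=; rewrite mulrA -eps_pull.
rewrite (sum_fcat (fun h => eps h * \prod_m E (h m) (fcat f' g' m))) mulr_suml.
rewrite [RHS](eq_bigr _ (fun f _ => mulr_suml _ _ _ _)) pair_bigA /=.
apply: eq_bigr => -[f g] _ /=; rewrite prod_fcat; ring.
Qed.

Lemma top_wedge34_pull E (alpha : kform A 3) (beta : kform A 4) :
  top_coef (wedge (form_pull E alpha) (form_pull E beta)) =
  \det E * top_coef (wedge alpha beta).
Proof.
rewrite !top_wedge34 (@sum_fcat_pull 3 4 E (\det E) (levi_civita A)).
  by rewrite mulrCA.
exact: sum_levi_civita_mx_tr.
Qed.

Lemma top_wedge43_pull E (alpha : kform A 4) (beta : kform A 3) :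
  top_coef (wedge (form_pull E alpha) (form_pull E beta)) =
  \det E * top_coef (wedge alpha beta).
Proof.
rewrite !top_wedge43 (@sum_fcat_pull 4 3 E (\det E) (levi_civita A)).
  by rewrite mulrCA.
exact: sum_levi_civita_mx_tr.
Qed.

(** The Hodge star in an oriented orthonormal frame, that is, [hodge3] for the identity metric and
    volume coefficient 1. *)
Definition flat_star (F : kform A 3) : kform A 4 := fun g =>
  (3`!)%:R^-1 * \sum_(k : {ffun 'I_3 -> 'I_7}) F k * levi_civita A (@fcat 3 4 k g).

(** Orthonormality gives [invmx G] = [E^T *m E]. Raising indices is thus pulling back along [E],
    then along [E^T]; the latter joins the outer pullback so that [E] acts on all seven slots of the
    symbol, and the resulting determinant is cancelled by [s]. *)
Lemma form_pull_hodge3 E G (s : A) (phi : kform A 3) g :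
  E *m G *m E^T = 1%:M -> s * \det E = 1 ->
  form_pull E (hodge3 G s phi) g = flat_star (form_pull E phi) g.
Proof.
move=> EGE sdetE.
have EGEr : E *m (G *m E^T) = 1%:M by rewrite mulmxA.
have GEE : G *m (E^T *m E) = 1%:M by rewrite mulmxA (mulmx1C EGEr).
have [uG _] := mulmx1_unit GEE.
have invG : invmx G = E^T *m E.
  by rewrite -[RHS](mulKmx uG) GEE mulmx1.
rewrite form_pullE /hodge3 invG /flat_star.
under eq_bigr do under [X in _ * (_ * X)]eq_bigr do
  rewrite form_pull_mul form_pullE mulr_suml.
under eq_bigr do rewrite [X in _ * (_ * X)]exchange_big mulrCA mulr_sumr mulr_sumr /=.
rewrite exchange_big /= mulr_sumr; apply: eq_bigr => k _.
have -> : levi_civita A (@fcat 3 4 k g) = s * \sum_(h : {ffun 'I_7 -> 'I_7})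
    levi_civita A h * \prod_m E (@fcat 3 4 k g m) (h m).
  by rewrite sum_levi_civita_mx mulrA sdetE mul1r.
rewrite (@sum_fcat 3 4 (fun h => levi_civita A h *
  \prod_m E (@fcat 3 4 k g m) (h m))) exchange_big /= !mulr_sumr.
apply: eq_bigr => g' _; rewrite !mulr_sumr; apply: eq_bigr => f _.
rewrite (@prod_fcat 3 4).
under [X in X * _ * _]eq_bigr do rewrite mxE.
rewrite -/(@fcat 3 4 f g'); ring.
Qed.

(* The cyclic shift by three of seven indices is the square of the one by five,
   hence even. *)
Lemma levi_civita_fcatC (f : 'I_3 -> 'I_7) (g : 'I_4 -> 'I_7) :
  levi_civita A (@fcat 4 3 g f) = levi_civita A (@fcat 3 4 f g).
Proof.
pose u := perm (addIr (5%:R : 'I_7)).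
have -> : @fcat 4 3 g f = @fcat 3 4 f g \o (u * u)%g.
  apply/funext => x /=; rewrite permM !permE.
  case: (@split_ordP 4 3 x) => i ->; rewrite ?fcat_lshift ?fcat_rshift.
    rewrite (_ : _ + _ = @rshift 3 4 i) ?fcat_rshift //.
    by apply/val_inj; case: i => [[|[|[|[|]]]]].
  rewrite (_ : _ + _ = @lshift 3 4 i) ?fcat_lshift //.
  by apply/val_inj; case: i => [[|[|[|]]]].
by rewrite levi_civita_perm_comp odd_permM addbb mul1r.
Qed.

(** The component form of X /\ F = <X, star F> vol. With [F] the three-form in the frame, this is
    what lets the four-form replace it in d phi /\ phi. *)
Lemma top_wedge43_star (X : kform A 4) (F : kform A 3) :
  top_coef (wedge X F) =
  (4`!)%:R^-1 * \sum_(k : {ffun 'I_4 -> 'I_7}) X k * flat_star F k.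
Proof.
rewrite top_wedge43 -mulrA mulr_sumr; congr (_ * _); apply: eq_bigr => f _.
rewrite /flat_star !mulr_sumr; apply: eq_bigr => g _.
by rewrite levi_civita_fcatC; ring.
Qed.

Hypothesis nat_unit : forall n, n.+1%:R \is a @GRing.unit A.

Lemma alternating_noninj k (F : kform A k) (f : 'I_k -> 'I_7) :
  alternating F -> ~ injective f -> F f = 0.
Proof.
move=> altF ninj.
have [i [j [ij fij]]] : exists i j, i != j /\ f i = f j.
  apply: contrapT => H; apply: ninj => i j fij; apply/eqP/negPn/negP => ij.
  by apply: H; exists i, j.
have := altF (tperm i j) f; rewrite odd_tperm ij expr1 mulN1r.
rewrite (_ : f \o tperm i j = f); last first.
  by apply/funext => m /=; case: tpermP => // ->.
move=> /eqP; rewrite -subr_eq0 opprK -mulr2n -mulr_natr => /eqP F0.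
by apply: (mulIr (nat_unit 1)); rewrite F0 mul0r.
Qed.

(* The 4! permutations with prescribed values on three indices form a coset of
   the permutations of the remaining four. *)
Lemma sum_perm_restrict (X : ('I_3 -> 'I_7) -> A) :
  (forall f, ~ injective f -> X f = 0) ->
  \sum_(s : 'S_7) X (fun i => s (lshift 4 i)) =
  (4`!)%:R * \sum_(f : {ffun 'I_3 -> 'I_7}) X f.
Proof.
move=> X0.
rewrite (partition_big (fun s : 'S_7 => [ffun i : 'I_3 => s (lshift 4 i)]) xpredT) //=.
rewrite mulr_sumr; apply: eq_bigr => f _.
rewrite (eq_bigr (fun=> X f)); last first.
  by move=> s /eqP <-; rewrite ffun_eta.
have [injf|ninj] := pselect (injective f); last first.
  by rewrite X0 // mulr0 big1.
pose B := finset (fun x : 'I_7 => (3 <= x)%N).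
pose imf := finset (fun x => [exists i, f i == x]).
have card_imf : #|~: imf| = 4.
  apply/eqP; rewrite -(eqn_add2l #|imf|) cardsC card_ord.
  rewrite (_ : imf = f @: [set: 'I_3]%SET).
    by rewrite card_imset ?cardsT ?card_ord.
  apply/setP => x; rewrite inE; apply/existsP/imsetP => [[i /eqP <-]|[i _ ->]].
    by exists i; rewrite ?inE.
  by exists i.
(* [g] enumerates the complement of the image of [f], so [fcat f g] is a permutation extending [f].
   Dividing by it turns the permutations that restrict to [f] into those fixing 0, 1, 2, which
   [card_perm] counts. *)
pose g j : 'I_7 := enum_val (cast_ord (esym card_imf) j).
have fg_neq i j : f i != g j.
  apply/eqP => fg; have := enum_valP (cast_ord (esym card_imf) j).
  rewrite -/(g j) -fg !inE => /existsP; apply; by exists i.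
have injfg : injective (@fcat 3 4 f g).
  move=> x y; case: (@split_ordP 3 4 x) => i ->; case: (@split_ordP 3 4 y) => j ->;
    rewrite ?fcat_lshift ?fcat_rshift.
  - by move/injf ->.
  - by move=> fg; case/eqP: (fg_neq i j).
  - by move=> /esym fg; case/eqP: (fg_neq j i).
  by move/enum_val_inj/cast_ord_inj ->.
rewrite (reindex_inj (mulIg (perm injfg))) /=.
rewrite (eq_bigl (mem (perm_on B))); last first.
  move=> t; rewrite -[RHS]/(perm_on B t) /perm_on; apply/eqP/fintype.subsetP => [tf x|tB].
    rewrite inE; apply: contraR; rewrite inE -ltnNge => x3.
    have := congr1 (fun h : {ffun 'I_3 -> 'I_7} => h (Ordinal x3)) tf.
    rewrite ffunE permM permE.
    rewrite (_ : lshift 4 (Ordinal x3) = x); last exact: val_inj.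
    rewrite -(@fcat_lshift 3 4 f g (Ordinal x3)) => /injfg ->.
    by apply/eqP/val_inj.
  apply/ffunP => i; rewrite ffunE permM.
  have -> : t (lshift 4 i) = lshift 4 i.
    apply/eqP/negPn/negP => ti; have := tB (lshift 4 i).
    by rewrite inE => /(_ ti); rewrite inE leqNgt /= ltn_ord.
  by rewrite permE fcat_lshift.
rewrite sumr_const card_perm.
have -> : #|B| = 4.
  by rewrite cardsE -sum1_card big_mkcond /= !big_ord_recl big_ord0.
by rewrite mulr_natl.
Qed.

(** With the last four slots filled by the last four indices the symbol is a block triangular
    determinant, leaving a 3 by 3 minor. Its Leibniz terms force [k] to permute the first three
    indices, and each of the 3! permutations contributes the same value. *)
Lemma sum_levi_civita_rshift (Y : kform A 3) : alternating Y ->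
  \sum_(k : {ffun 'I_3 -> 'I_7})
     Y k * levi_civita A (@fcat 3 4 k (@rshift 3 4)) = 6%:R * Y (@lshift 3 4).
Proof.
move=> altY.
have lc (k : 'I_3 -> 'I_7) : levi_civita A (@fcat 3 4 k (@rshift 3 4)) =
    \det (\matrix_(a < 3, b < 3) (k a == lshift 4 b)%:R).
  have := @det_ublock _ 3 4 (\matrix_(a, b) (k a == @lshift 3 4 b)%:R)
    (\matrix_(a, b) (k a == @rshift 3 4 b)%:R) (1%:M : 'M[A]_4).
  rewrite det1 mulr1 => <-.
  congr (\det _); apply/matrixP => a b; rewrite mxE.
  case: (@split_ordP 3 4 a) => i ->; case: (@split_ordP 3 4 b) => j ->;
    rewrite ?fcat_lshift ?fcat_rshift.
  - by rewrite [RHS](@block_mxEul A 3 4 3 4) mxE.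
  - by rewrite [RHS](@block_mxEur A 3 4 3 4) mxE.
  - by rewrite [RHS](@block_mxEdl A 3 4 3 4) mxE -val_eqE /= gtn_eqF // ltn_addr.
  by rewrite [RHS](@block_mxEdr A 3 4 3 4) mxE -val_eqE /= eqn_add2l.
under eq_bigr do rewrite lc /determinant mulr_sumr.
rewrite exchange_big /=.
transitivity (\sum_(t : 'S_3) Y (@lshift 3 4)); last first.
  by rewrite sumr_const card_Sn mulr_natl.
apply: eq_bigr => t _; rewrite (bigD1 [ffun a => lshift 4 (t a)]) //=.
rewrite [X in _ + X]big1 ?addr0; last first.
  move=> k /eqP kt; have /existsP[a ka] : [exists a, k a != lshift 4 (t a)].
    apply/existsP; apply: contrapT => eqk; apply: kt; apply/ffunP => a.
    by rewrite ffunE; apply/eqP; apply: contrapT => ka; apply: eqk; exists a; apply/negP.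
  by rewrite (bigD1 a) //= mxE (negbTE ka) mul0r !mulr0.
rewrite big1 ?mulr1 => [|a _]; last by rewrite mxE ffunE eqxx.
by rewrite ffun_eta (altY t (@lshift 3 4)) mulrAC -expr2 sqrr_sign mul1r.
Qed.

(** H /\ star F = <H, F> vol. Every term of the permutation sum reduces to the standard splitting of
    the seven indices, so it depends only on the values of the permutation on the first three;
    [sum_perm_restrict] then counts repetitions. *)
Lemma top_wedge_flat_star (H F : kform A 3) : alternating F ->
  top_coef (wedge H (flat_star F)) =
  (3`!)%:R^-1 * \sum_(f : {ffun 'I_3 -> 'I_7}) H f * F f.
Proof.
move=> altF; rewrite /top_coef /wedge -mulrA; congr (_ * _).
transitivity ((4`!)%:R^-1 * \sum_(s : 'S_7)
   H (fun i => s (lshift 4 i)) * F (fun i => s (lshift 4 i))).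
  congr (_ * _); apply: eq_bigr => s _; rewrite /flat_star.
  (* Substituting [s] composed with [k] makes [s] act on all seven slots of the symbol. It leaves as
     a sign, which squares to 1 against the sign in [wedge]. *)
  rewrite (reindex_inj (h := fun k : {ffun 'I_3 -> 'I_7} => [ffun i => s (k i)])) /=;
    last first.
    by move=> k k' /ffunP kk; apply/ffunP => i; have := kk i; rewrite !ffunE => /perm_inj.
  have -> : \sum_(k : {ffun 'I_3 -> 'I_7}) F [ffun i => s (k i)] *
      levi_civita A (@fcat 3 4 [ffun i => s (k i)] (fun j => s (rshift 3 j))) =
      (-1) ^+ odd_perm s * (6%:R * F (fun i => s (lshift 4 i))).
    rewrite -(sum_levi_civita_rshift (Y := fun k => F (s \o k))).
      rewrite mulr_sumr; apply: eq_bigr => k _; rewrite ffun_eta -/(s \o k).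
      by rewrite -/(s \o @rshift 3 4) -comp_fcat levi_civita_comp_perm mulrCA.
    by move=> t k; rewrite -altF.
  have u6 : 6%:R * (3`!)%:R^-1 = 1 :> A by rewrite (mulrV (nat_unit 5)).
  have := sqrr_sign A s; rewrite expr2; set e := (-1) ^+ _ => ss.
  transitivity ((e * e) * (6%:R * (3`!)%:R^-1) *
    (H (fun i => s (lshift 4 i)) * F (fun i => s (lshift 4 i)))).
    set c := (3`!)%:R^-1; ring.
  by rewrite ss u6 !mul1r.
rewrite (sum_perm_restrict (X := fun f => H f * F f)).
  by rewrite mulrA mulVr ?mul1r // nat_unit.
by move=> f ninj; rewrite (alternating_noninj altF) ?mulr0.
Qed.
End Forms.

(** * Alternating forms, their contraction with wedge products, and pullback of wedges *)

Section Alternation.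
Variable A : comUnitRingType.

Lemma alternating_tperm k (X : kform A k) :
  (forall (i j : 'I_k) f, i != j -> X (f \o tperm i j) = - X f) ->
  alternating X.
Proof.
move=> Xt s; have [ts -> {s}] := prod_tpermP s.
elim: ts => [_ f|[i j] ts IHts /= /andP[ij dts] f].
  rewrite big_nil odd_perm1 mul1r; congr X.
  by apply/funext => m /=; rewrite perm1.
rewrite big_cons odd_permM odd_tperm ij addTb signrN mulNr -IHts // -(Xt i j) //.
by congr X; apply/funext => m /=; rewrite permM.
Qed.

(** Adjacent transpositions generate the symmetric group, so antisymmetry of the gamma bilinears
    needs only the swap of neighbouring gammas, which is the Clifford relation. *)
Lemma alternating_adj k (X : kform A k) :
  (forall (i j : 'I_k) f, j = i.+1 :> nat -> X (f \o tperm i j) = - X f) ->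
  alternating X.
Proof.
move=> Xadj.
have Xlt d (i j : 'I_k) f : j = (i + d).+1 :> nat -> X (f \o tperm i j) = - X f.
  elim: d j f => [|d IHd] j f jd; first by apply: Xadj; rewrite jd addn0.
  have lk : (i + d.+1 < k)%N by apply: ltn_trans (ltn_ord j); rewrite jd.
  pose l := Ordinal lk.
  (* With [l] the predecessor of [j], conjugating by an adjacent transposition shortens the distance
     by one; the three signs multiply to -1. *)
  have -> : tperm i j = (tperm l j * tperm i l * tperm l j)%g.
    rewrite -[X in (X * _ * _)%g]tpermV -mulgA -/(conjg _ _) tpermJ tpermL tpermD //.
      by rewrite -val_eqE /= gtn_eqF // addnS ltnS leq_addr.
    by rewrite -val_eqE /= jd gtn_eqF // ltnS leq_addr.
  transitivity (X (f \o tperm l j \o tperm i l \o tperm l j)).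
    by congr X; apply/funext => m /=; rewrite !permM.
  rewrite (Xadj l j) ?jd //. rewrite IHd; last by rewrite /= addnS.
  by rewrite opprK Xadj.
apply: alternating_tperm => i j f ij.
have [ltij|ltji|/val_inj eqij] := ltngtP i j; last by rewrite eqij eqxx in ij.
  by apply: (Xlt (j - i.+1)%N); rewrite -addSn subnKC.
by rewrite tpermC; apply: (Xlt (i - j.+1)%N); rewrite -addSn subnKC.
Qed.

Lemma alternation_id k (X : kform A k) f : k`!%:R \is a @GRing.unit A ->
  alternating X ->
  k`!%:R^-1 * \sum_(t : 'S_k) (-1) ^+ odd_perm t * X (f \o t) = X f.
Proof.
move=> uk altX; rewrite (eq_bigr (fun=> X f)) => [|t _]; last first.
  by rewrite altX mulrA -expr2 sqrr_sign mul1r.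
by rewrite sumr_const card_Sn -[X f *+ _]mulr_natl mulKr.
Qed.

Lemma alternation_sym0 k (X : kform A k) (i j : 'I_k) f :
  2%:R \is a @GRing.unit A -> i != j -> (forall f, X (f \o tperm i j) = X f) ->
  \sum_(t : 'S_k) (-1) ^+ odd_perm t * X (f \o t) = 0.
Proof.
move=> u2 ij Xsym; set S := \sum_(t : 'S_k) _.
have SN : S = - S.
  rewrite [in LHS]/S (reindex_inj (mulgI (tperm i j))) -sumrN /=.
  apply: eq_bigr => t _; rewrite odd_permM odd_tperm ij addTb signrN mulNr.
  rewrite -[in RHS]Xsym; congr (- (_ * X _)).
  by apply/funext => m /=; rewrite permM.
by apply: (mulrI u2); rewrite mulr0 mulr_natl mulr2n {1}SN addNr.
Qed.

Lemma alternating_fcatl k l (Q : kform A (k + l)) (g : 'I_l -> 'I_7) :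
  alternating Q -> alternating (fun f => Q (fcat f g)).
Proof.
move=> altQ; apply: alternating_tperm => i j f ij.
have := altQ (tperm (lshift l i) (lshift l j)) (fcat f g).
rewrite odd_tperm eq_lshift ij expr1 mulN1r => <-.
congr Q; apply/funext => m /=; case: (split_ordP m) => a ->.
  by rewrite fcat_lshift /= -inj_tperm ?fcat_lshift //; exact: lshift_inj.
by rewrite fcat_rshift tpermD ?fcat_rshift // eq_lrshift.
Qed.

(** Against an alternating [Q] the antisymmetrisation inside [wedge] is redundant: after relabelling
    the summation indices each of the (k + l)! permutations contributes equally. *)
Lemma sum_wedge_alternating k l (alpha : kform A k) (beta : kform A l)
    (Q : kform A (k + l)) : alternating Q ->
  \sum_(h : {ffun 'I_(k + l) -> 'I_7}) wedge alpha beta h * Q h =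
  (k`!)%:R^-1 * (l`!)%:R^-1 * ((k + l)`!)%:R *
  \sum_(f : {ffun 'I_k -> 'I_7}) alpha f *
    \sum_(g : {ffun 'I_l -> 'I_7}) beta g * Q (fcat f g).
Proof.
move=> altQ; rewrite /wedge.
under eq_bigr => h _ do rewrite -(mulrA _ _ (Q h)).
rewrite -mulr_sumr -mulrA; congr (_ * _).
under eq_bigr do rewrite mulr_suml.
rewrite exchange_big /=.
transitivity (\sum_(s : 'S_(k + l)) \sum_(h : {ffun 'I_(k + l) -> 'I_7})
   alpha (fun i => h (lshift l i)) * beta (fun j => h (rshift k j)) * Q h).
  apply: eq_bigr => s _.
  rewrite [RHS](reindex_inj (h := fun h : {ffun 'I_(k + l) -> 'I_7} =>
    [ffun i => h (s i)])) /=; last first.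
    move=> h h' /ffunP hh; apply/ffunP => i.
    by have := hh (s^-1%g i); rewrite !ffunE permKV.
  apply: eq_bigr => h _; have -> : Q [ffun i => h (s i)] = (-1) ^+ odd_perm s * Q h.
    by rewrite ffun_eta -altQ.
  have reorder (e a b q : A) : e * a * b * q = a * b * (e * q) by ring.
  by rewrite ffun_eta reorder.
rewrite sumr_const card_Sn mulr_natl; congr (_ *+ _).
rewrite (sum_fcat (fun h => alpha (fun i => h (lshift l i)) *
  beta (fun j => h (rshift k j)) * Q h)).
apply: eq_bigr => f _; rewrite mulr_sumr; apply: eq_bigr => g _.
by rewrite wedge_fcat mulrA.
Qed.

Lemma sum_delta1 (c : 'I_7) (X : kform A 1) :
  \sum_(f : {ffun 'I_1 -> 'I_7}) (f ord0 == c)%:R * X f = X (fun=> c).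
Proof.
rewrite (bigD1 [ffun=> c]) //= ffunE eqxx mul1r ffun_eta big1 ?addr0 // => f fc.
case: eqP => [f0|_]; last by rewrite mul0r.
by case/eqP: fc; apply/ffunP => i; rewrite ffunE ord1.
Qed.

Lemma form_pull_wedge k l E (alpha : kform A k) (beta : kform A l) f :
  form_pull E (wedge alpha beta) f =
  wedge (form_pull E alpha) (form_pull E beta) f.
Proof.
rewrite form_pullE /wedge.
under eq_bigr do rewrite mulrCA mulr_sumr.
rewrite -mulr_sumr exchange_big /=; congr (_ * _); apply: eq_bigr => s _.
have reorder (p e a b : A) : p * (e * a * b) = e * (p * (a * b)) by ring.
under eq_bigr do rewrite reorder.
rewrite -mulr_sumr -[RHS]mulrA; congr (_ * _); rewrite !form_pullE.
rewrite (reindex_inj (h := fun h : {ffun 'I_(k + l) -> 'I_7} =>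
  [ffun i => h (s^-1%g i)])) /=; last first.
  move=> h h' /ffunP hh; apply/ffunP => i.
  by have := hh (s i); rewrite !ffunE permK.
rewrite (eq_bigr (fun h : {ffun 'I_(k + l) -> 'I_7} =>
  (\prod_m E (f (s m)) (h m)) *
  (alpha (fun i => h (lshift l i)) * beta (fun j => h (rshift k j))))); last first.
  move=> h _; rewrite (reindex_inj (@perm_inj _ s)) /=.
  congr (_ * (_ * _)).
  - by apply: eq_bigr => m _; rewrite ffunE permK.
  - by congr alpha; apply/funext => m; rewrite ffunE permK.
  - by congr beta; apply/funext => m; rewrite ffunE permK.
rewrite (sum_fcat (fun h => (\prod_m E (f (s m)) (h m)) *
  (alpha (fun i => h (lshift l i)) * beta (fun j => h (rshift k j))))).
rewrite big_distrlr /=; apply: eq_bigr => f' _; apply: eq_bigr => g' _.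
rewrite wedge_fcat big_split_ord mulrACA /=.
by congr (_ * _ * (_ * _)); apply: eq_bigr => m _;
  rewrite ?fcat_lshift ?fcat_rshift.
Qed.

(** In an orthonormal frame the metric dual of a frame vector is the dual coframe element. *)
Lemma form_pull_flat E G c f : E *m G *m E^T = 1%:M ->
  form_pull E (flat (A := A) G (row c E)) f = (f ord0 == c)%:R.
Proof.
move=> EGE; rewrite form_pullE /flat -row_mul.
transitivity ((E *m G *m E^T) c (f ord0)); last first.
  by rewrite EGE mxE eq_sym.
rewrite [RHS]mxE (reindex (fun b : 'I_7 => [ffun _ : 'I_1 => b])) /=; last first.
  exists (fun h : {ffun 'I_1 -> 'I_7} => h ord0) => h _; first by rewrite ffunE.
  by apply/ffunP => i; rewrite ffunE (ord1 i).
by apply: eq_bigr => b _; rewrite big_ord1 !ffunE mulrC !mxE.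
Qed.
End Alternation.

Section SmallIndices.
Variable V : nmodType.

Lemma tnth3E (a b c : 'I_7) (g := tnth [tuple a; b; c]) :
  (g (inord 0) = a) * (g (inord 1) = b) * (g (inord 2) = c).
Proof. by rewrite /g !(tnth_nth ord0) !inordK. Qed.

Lemma tnth4E (a b c d : 'I_7) (g := tnth [tuple a; b; c; d]) :
  (g (inord 0) = a) * (g (inord 1) = b) * (g (inord 2) = c) * (g (inord 3) = d).
Proof. by rewrite /g !(tnth_nth ord0) !inordK. Qed.

Lemma tnth3_eta T (h : 'I_3 -> T) :
  tnth [tuple h (inord 0); h (inord 1); h (inord 2)] = h.
Proof.
apply/funext => -[[|[|[|//]]] p]; rewrite (tnth_nth (h (inord 0))) /=;
  by congr h; apply/val_inj; rewrite /= inordK.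
Qed.

Lemma tnth4_eta T (h : 'I_4 -> T) :
  tnth [tuple h (inord 0); h (inord 1); h (inord 2); h (inord 3)] = h.
Proof.
apply/funext => -[[|[|[|[|//]]]] p]; rewrite (tnth_nth (h (inord 0))) /=;
  by congr h; apply/val_inj; rewrite /= inordK.
Qed.

Lemma sum_ffun3 (X : ('I_3 -> 'I_7) -> V) :
  \sum_(f : {ffun 'I_3 -> 'I_7}) X f =
  \sum_a \sum_b \sum_c X (tnth [tuple a; b; c]).
Proof.
rewrite pair_bigA pair_bigA /=.
rewrite (reindex (fun p : 'I_7 * 'I_7 * 'I_7 =>
    finfun (tnth [tuple p.1.1; p.1.2; p.2]))) /=.
  by apply: eq_bigr => p _; rewrite ffun_eta.
exists (fun h : {ffun 'I_3 -> 'I_7} => (h (inord 0), h (inord 1), h (inord 2))).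
  by move=> [[a b] c] _ /=; rewrite ffun_eta !tnth3E.
by move=> h _; apply/ffunP => i; rewrite ffunE tnth3_eta.
Qed.

Lemma sum_ffun4 (X : ('I_4 -> 'I_7) -> V) :
  \sum_(f : {ffun 'I_4 -> 'I_7}) X f =
  \sum_a \sum_b \sum_c \sum_d X (tnth [tuple a; b; c; d]).
Proof.
rewrite pair_bigA pair_bigA pair_bigA /=.
rewrite (reindex (fun p : 'I_7 * 'I_7 * 'I_7 * 'I_7 =>
    finfun (tnth [tuple p.1.1.1; p.1.1.2; p.1.2; p.2]))) /=.
  by apply: eq_bigr => p _; rewrite ffun_eta.
exists (fun h : {ffun 'I_4 -> 'I_7} =>
  (h (inord 0), h (inord 1), h (inord 2), h (inord 3))).
  by move=> [[[a b] c] d] _ /=; rewrite ffun_eta !tnth4E.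
by move=> h _; apply/ffunP => i; rewrite ffunE tnth4_eta.
Qed.

Lemma inord_neq n i j : (i <= n)%N -> (j <= n)%N -> i != j ->
  inord i != inord j :> 'I_n.+1.
Proof. by move=> ilt jlt ij; rewrite -val_eqE /= !inordK. Qed.
End SmallIndices.

Section BigOps.
Variable V : pzSemiRingType.
Lemma prod_ord3 (F : 'I_3 -> V) :
  \prod_(m < 3) F m = F (inord 0) * (F (inord 1) * F (inord 2)).
Proof.
rewrite !big_ord_recl big_ord0 mulr1.
by congr (F _ * (F _ * F _)); apply/val_inj; rewrite /= inordK.
Qed.

Lemma prod_ord4 (F : 'I_4 -> V) :
  \prod_(m < 4) F m = F (inord 0) * (F (inord 1) * (F (inord 2) * F (inord 3))).
Proof.
rewrite !big_ord_recl big_ord0 mulr1.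
by congr (F _ * (F _ * (F _ * F _))); apply/val_inj; rewrite /= inordK.
Qed.
End BigOps.

(** * Clifford algebra bilinears of a unit spinor *)

Section Clifford.
Variable A : comUnitRingType.
Hypothesis nat_unit : forall n, n.+1%:R \is a @GRing.unit A.
Variables (gam : 'I_7 -> 'M[A]_8) (B : 'M[A]_8).
Hypothesis gam_clifford : forall a b,
  gam a *m gam b + gam b *m gam a = (- 2%:R * (a == b)%:R)%:M.
Hypothesis B_sym : B^T = B.
Hypothesis B_invariant : forall a, (gam a)^T *m B *m gam a = B.

Notation "''d_' ( a , b )" := ((a == b)%:R : A) (at level 0, format "''d_' ( a ,  b )").

Definition bform (x y : 'cV[A]_8) : A := (x^T *m B *m y) 0 0.

Lemma bformC x y : bform x y = bform y x.
Proof.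
rewrite /bform -[in LHS](trmxK (x^T *m B *m y)) mxE.
by rewrite !trmx_mul trmxK B_sym mulmxA.
Qed.

Lemma bformDr x y z : bform x (y + z) = bform x y + bform x z.
Proof. by rewrite /bform mulmxDr mxE. Qed.

Lemma bformZr c x y : bform x (c *: y) = c * bform x y.
Proof. by rewrite /bform -scalemxAr mxE. Qed.

Lemma bformNr x y : bform x (- y) = - bform x y.
Proof. by rewrite /bform mulmxN mxE. Qed.

Lemma bform_sumr (I : finType) (F : I -> 'cV[A]_8) x :
  bform x (\sum_i F i) = \sum_i bform x (F i).
Proof. by rewrite /bform mulmx_sumr summxE. Qed.

Lemma bformDl x y z : bform (x + y) z = bform x z + bform y z.
Proof. by rewrite bformC bformDr -!(bformC z). Qed.

Lemma bformZl c x y : bform (c *: x) y = c * bform x y.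
Proof. by rewrite bformC bformZr (bformC y). Qed.

Lemma double_inj (x y : A) : x + x = y + y -> x = y.
Proof.
by rewrite -!mulr2n -[x *+ 2]mulr_natl -[y *+ 2]mulr_natl => /(mulrI (nat_unit 1)).
Qed.

Lemma gamK a (v : 'cV[A]_8) : gam a *m (gam a *m v) = - v.
Proof.
apply/matrixP => i j; apply: double_inj; rewrite mulmxA.
have := congr1 (fun X : 'M[A]_8 => (X *m v) i j) (gam_clifford a a).
by rewrite mulmxDl mul_scalar_mx eqxx mulr1 !mxE => ->; ring.
Qed.

Lemma gam_swap a b (v : 'cV[A]_8) :
  gam a *m (gam b *m v) = - (gam b *m (gam a *m v)) - (2%:R * 'd_(a, b)) *: v.
Proof.
rewrite -scaleNr -mulNr -mul_scalar_mx -gam_clifford mulmxDl !mulmxA.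
by rewrite addrCA addNr addr0.
Qed.

(** Invariance says that [gam a] is orthogonal; since its square is -1, it is then skew. *)
Lemma bform_gam a x y : bform (gam a *m x) y = - bform x (gam a *m y).
Proof.
have inv u v : bform (gam a *m u) (gam a *m v) = bform u v.
  by rewrite /bform trmx_mul -{2}(B_invariant a) !mulmxA.
by rewrite -(inv x) gamK bformNr opprK.
Qed.

Variable chi : 'cV[A]_8.
Hypothesis chi_unit : bform chi chi = 1.

Lemma bform_gam1 a : bform chi (gam a *m chi) = 0.
Proof. by apply: double_inj; rewrite {1}bformC bform_gam addNr addr0. Qed.

Lemma bform_gam2 a b : bform chi (gam a *m (gam b *m chi)) = - 'd_(a, b).
Proof.
apply: double_inj; rewrite {1}gam_swap bformDr !bformNr bformZr chi_unit.
rewrite -[bform chi (gam b *m _)]opprK -bform_gam bformC bform_gam; ring.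
Qed.

(** No antisymmetrisation is written: the corrections are multiples of <chi, gam a chi>, which
    vanish. *)
Definition spin3 a b c := bform chi (gam a *m (gam b *m (gam c *m chi))).

Lemma spin3_swap12 a b c : spin3 b a c = - spin3 a b c.
Proof.
by rewrite /spin3 gam_swap bformDr !bformNr bformZr bform_gam1 mulr0 subr0.
Qed.

Lemma spin3_swap23 a b c : spin3 a c b = - spin3 a b c.
Proof.
rewrite /spin3 (gam_swap c b) mulmxDr !mulmxN -scalemxAr.
by rewrite bformDr !bformNr bformZr bform_gam1 mulr0 subr0.
Qed.

(** The totally antisymmetric part of the four-gamma bilinear. The delta products remove its trace
    part, whose coefficients come from [bform_gam2] and thus from the normalisation of [chi]. The
    four-form [psi] is its negative. *)
Definition spin4 a b c d :=
  bform chi (gam a *m (gam b *m (gam c *m (gam d *m chi))))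
  - 'd_(a, b) * 'd_(c, d) + 'd_(a, c) * 'd_(b, d) - 'd_(a, d) * 'd_(b, c).

Lemma spin4_swap12 a b c d : spin4 b a c d = - spin4 a b c d.
Proof.
rewrite /spin4 (gam_swap b a) bformDr !bformNr bformZr bform_gam2 (eq_sym b a).
ring.
Qed.

Lemma spin4_swap23 a b c d : spin4 a c b d = - spin4 a b c d.
Proof.
rewrite /spin4 (gam_swap c b) mulmxDr !mulmxN -scalemxAr.
rewrite bformDr !bformNr bformZr bform_gam2 (eq_sym c b); ring.
Qed.

Lemma spin4_swap34 a b c d : spin4 a b d c = - spin4 a b c d.
Proof.
rewrite /spin4 (gam_swap d c) !mulmxDr !mulmxN -!scalemxAr.
rewrite bformDr !bformNr bformZr bform_gam2 (eq_sym d c); ring.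
Qed.

(* The matrix with columns chi, gam_a chi is orthogonal for the pairing. *)
Lemma spinor_completeness v :
  \sum_d bform (gam d *m chi) v *: (gam d *m chi) = v - bform chi v *: chi.
Proof.
pose n (j : 'I_8) := oapp (fun a => gam a *m chi) chi (unlift ord0 j).
pose N : 'M[A]_8 := \matrix_(i, j) n j i 0.
have bNN : N^T *m (B *m N) = 1%:M.
  apply/matrixP => j k.
  have -> : (N^T *m (B *m N)) j k = bform (n j) (n k).
    rewrite mulmxA /bform !mxE; apply: eq_bigr => l _; rewrite !mxE.
    by congr (_ * _); apply: eq_bigr => i _; rewrite !mxE.
  rewrite mxE /n; case: (unliftP ord0 j) => [a|] ->;
    case: (unliftP ord0 k) => [b|] ->; rewrite /= ?liftK ?unlift_none /=.
  - by rewrite bform_gam bform_gam2 opprK (inj_eq lift_inj).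
  - by rewrite bform_gam bform_gam1 oppr0.
  - by rewrite bform_gam1.
  by rewrite chi_unit.
(* Orthonormality makes [N^T *m B] a left inverse of [N]. As 8 = 1 + 7, [N] is square, so this is
   also a right inverse, which is completeness. *)
rewrite mulmxA in bNN.
have : v = N *m (N^T *m B *m v) by rewrite mulmxA (mulmx1C bNN) mul1mx.
have NE (w : 'cV[A]_8) : N *m w = w ord0 0 *: chi +
    \sum_a w (lift ord0 a) 0 *: (gam a *m chi).
  apply/matrixP => i z; rewrite (ord1 z) mxE big_ord_recl !mxE /n unlift_none /=.
  rewrite mulrC; congr (_ + _); rewrite summxE; apply: eq_bigr => a _.
  by rewrite !mxE /n liftK /= mulrC !mxE.
rewrite NE.
have wE j : (N^T *m B *m v) j 0 = bform (n j) v.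
  rewrite /bform !mxE; apply: eq_bigr => l _; congr (_ * _).
  by rewrite !mxE; apply: eq_bigr => i _; rewrite !mxE.
rewrite wE /n unlift_none /= => vE.
rewrite [X in _ = X - _]vE addrAC subrr add0r; apply: eq_bigr => a _.
by rewrite wE /n liftK.
Qed.

Lemma sum_deltaZ (V : lmodType A) m (F : 'I_7 -> V) :
  \sum_b 'd_(m, b) *: F b = F m.
Proof.
rewrite (bigD1 m) //= eqxx scale1r big1 ?addr0 // => b.
by rewrite eq_sym => /negbTE ->; rewrite scale0r.
Qed.

Lemma sum_const7 (V : lmodType A) (v : V) : \sum_(b < 7) v = 7%:R *: v.
Proof. by rewrite sumr_const card_ord -scaler_nat. Qed.

(** [spinor_completeness] removes one index at a time, innermost first, and 43 = 7 * (7 - 1) + 1: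
    the sum over [d] leaves u, the sum over [c] makes it 7u - u, the sum over [b] multiplies by 7,
    and the last projection adds u. *)
Lemma gam_contract m :
  \sum_b \sum_c \sum_d
    gam b *m (gam c *m (bform (gam d *m chi) (gam c *m (gam b *m (gam m *m chi)))
      *: (gam d *m chi))) = 43%:R *: (gam m *m chi).
Proof.
set u := gam m *m chi.
have sum_d b c : \sum_d gam b *m (gam c *m
      (bform (gam d *m chi) (gam c *m (gam b *m u)) *: (gam d *m chi))) =
    u + gam b *m (bform (gam c *m chi) (gam b *m u) *: (gam c *m chi)).
  rewrite -!mulmx_sumr spinor_completeness !mulmxDr !mulmxN !gamK mulmxN gamK.
  by rewrite opprK bform_gam scaleNr mulmxN -!scalemxAr.
under eq_bigr do under eq_bigr do rewrite sum_d.
have sum_c b : \sum_c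
    (u + gam b *m (bform (gam c *m chi) (gam b *m u) *: (gam c *m chi))) =
    7%:R *: u - u + bform (gam b *m chi) u *: (gam b *m chi).
  rewrite big_split /= sum_const7 -mulmx_sumr spinor_completeness.
  by rewrite mulmxDr mulmxN gamK -scalemxAr bform_gam scaleNr addrA.
under eq_bigr do rewrite sum_c.
rewrite big_split /= sum_const7 spinor_completeness bform_gam1 scale0r subr0.
rewrite -[X in _ *: (_ - X)]scale1r -scalerBl scalerA -[X in _ + X]scale1r.
by rewrite -scalerDl; congr (_ *: _); ring.
Qed.

(* 24 = 43 - 7 - 5 - 7: gam_contract and the three trace terms of spin4. *)
Lemma spin4_contract m :
  \sum_b \sum_c \sum_d
    - spin4 m b c d *: (gam b *m (gam c *m (gam d *m chi))) = 24%:R *: (gam m *m chi).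
Proof.
set u := gam m *m chi.
(* Gammas are moved across the pairing until only [gam d] stands beside [chi] in the left argument,
   the shape to which completeness in [d] applies. *)
have term b c d : - spin4 m b c d *: (gam b *m (gam c *m (gam d *m chi))) =
    gam b *m (gam c *m (bform (gam d *m chi) (gam c *m (gam b *m u))
      *: (gam d *m chi)))
    + 'd_(m, b) *: ('d_(c, d) *: (gam b *m (gam c *m (gam d *m chi))))
    - 'd_(m, c) *: ('d_(b, d) *: (gam b *m (gam c *m (gam d *m chi))))
    + 'd_(m, d) *: ('d_(b, c) *: (gam b *m (gam c *m (gam d *m chi)))).
  rewrite -!scalemxAr !scalerA -scalerDl -scalerBl -scalerDl; congr (_ *: _).
  have -> : bform (gam d *m chi) (gam c *m (gam b *m u)) =
      bform u (gam b *m (gam c *m (gam d *m chi))).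
    by rewrite [RHS]bformC !bform_gam opprK.
  by rewrite /spin4 bform_gam; ring.
under eq_bigr do under eq_bigr do under eq_bigr do rewrite term.
have sum3D (V : zmodType) (F G : 'I_7 -> 'I_7 -> 'I_7 -> V) :
    \sum_b \sum_c \sum_d (F b c d + G b c d) =
    \sum_b \sum_c \sum_d F b c d + \sum_b \sum_c \sum_d G b c d.
  rewrite -big_split; apply: eq_bigr => b _ /=; rewrite -big_split.
  by apply: eq_bigr => c _ /=; rewrite -big_split.
have sum3N (V : zmodType) (F : 'I_7 -> 'I_7 -> 'I_7 -> V) :
    \sum_b \sum_c \sum_d (- F b c d) = - \sum_b \sum_c \sum_d F b c d.
  rewrite -sumrN; apply: eq_bigr => b _ /=; rewrite -sumrN.
  by apply: eq_bigr => c _ /=; rewrite -sumrN.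
rewrite !sum3D sum3N gam_contract -/u.
have -> : \sum_b \sum_c \sum_d
    'd_(m, b) *: ('d_(c, d) *: (gam b *m (gam c *m (gam d *m chi)))) = - 7%:R *: u.
  under eq_bigr do under eq_bigr do rewrite -scaler_sumr sum_deltaZ gamK.
  under eq_bigr do rewrite -scaler_sumr.
  by rewrite sum_deltaZ sum_const7 mulmxN scalerN scaleNr.
(* The deltas leave the sum over b of gam b gam m gam b, which is (7 - 2) gam m: seven from the
   squares, minus two from the anticommutator at b = m. *)
have -> : \sum_b \sum_c \sum_d
    'd_(m, c) *: ('d_(b, d) *: (gam b *m (gam c *m (gam d *m chi)))) = 5%:R *: u.
  under eq_bigr do under eq_bigr do rewrite -scaler_sumr sum_deltaZ.
  under eq_bigr => b _ do
    rewrite sum_deltaZ gam_swap gamK mulmxN opprK eq_sym -scalerA.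
  rewrite sumrB sum_const7 -scaler_sumr sum_deltaZ -scalerBl.
  by congr (_ *: _); ring.
have -> : \sum_b \sum_c \sum_d
    'd_(m, d) *: ('d_(b, c) *: (gam b *m (gam c *m (gam d *m chi)))) = - 7%:R *: u.
  under eq_bigr do under eq_bigr do rewrite sum_deltaZ.
  under eq_bigr do rewrite sum_deltaZ gamK.
  by rewrite sum_const7 scalerN scaleNr.
by rewrite -scalerDl -scalerBl -scalerDl; congr (_ *: _); ring.
Qed.

(** The derivative of [spin3] at [chi] in the direction [eta], with one term for each occurrence of
    the spinor. *)
Definition spin_triple (eta : 'cV[A]_8) b c d :=
  bform eta (gam b *m (gam c *m (gam d *m chi))) +
  bform chi (gam b *m (gam c *m (gam d *m eta))).

(** 48 = 2 * 24, as both terms of [spin_triple] contribute equally: transposing three gammas costs a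
    sign and reverses their order, and reversing the last three indices of [spin4] costs another. *)
Lemma spin4_triple m eta :
  \sum_b \sum_c \sum_d spin4 m b c d * spin_triple eta b c d =
  48%:R * bform chi (gam m *m eta).
Proof.
pose S := \sum_b \sum_c \sum_d
  spin4 m b c d * bform eta (gam b *m (gam c *m (gam d *m chi))).
have SE : S = 24%:R * bform chi (gam m *m eta).
  rewrite -[bform chi _]opprK -bform_gam bformC mulrN -bformZr -spin4_contract.
  rewrite !bform_sumr -sumrN; apply: eq_bigr => b _.
  rewrite !bform_sumr -sumrN; apply: eq_bigr => c _.
  rewrite !bform_sumr -sumrN; apply: eq_bigr => d _.
  by rewrite bformZr mulNr opprK.
have TE : \sum_b \sum_c \sum_d
    spin4 m b c d * bform chi (gam b *m (gam c *m (gam d *m eta))) = S.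
  rewrite exchange_big /= (eq_bigr _ (fun c _ => exchange_big _ _ _ _ _ _)) /=.
  rewrite exchange_big /=; apply: eq_bigr => b _; apply: eq_bigr => c _.
  apply: eq_bigr => d _; rewrite [bform eta _]bformC !bform_gam opprK mulrN -mulNr.
  by rewrite spin4_swap34 spin4_swap23 spin4_swap34 !opprK.
have -> : \sum_b \sum_c \sum_d spin4 m b c d * spin_triple eta b c d = S + S.
  rewrite -{2}TE -big_split; apply: eq_bigr => b _; rewrite -big_split.
  apply: eq_bigr => c _; rewrite -big_split; apply: eq_bigr => d _.
  by rewrite mulrDr.
by rewrite SE; ring.
Qed.

Lemma spin3_alternating :
  alternating (fun f : 'I_3 -> 'I_7 =>
    spin3 (f (inord 0)) (f (inord 1)) (f (inord 2))).
Proof.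
apply: alternating_adj => i j f ij.
have [[-> ->]|[-> ->]] : i = inord 0 /\ j = inord 1 \/ i = inord 1 /\ j = inord 2.
  case: i ij => -[|[|i]] lti /= ij; [left|right|].
  - by split; apply/val_inj; rewrite /= inordK.
  - by split; apply/val_inj; rewrite /= inordK.
  by have := ltn_ord j; rewrite ij.
  by rewrite /= tpermL tpermR tpermD ?inord_neq // spin3_swap12.
by rewrite /= tpermL tpermR tpermD ?inord_neq // spin3_swap23.
Qed.

Lemma spin4_alternating :
  alternating (fun f : 'I_4 -> 'I_7 =>
    spin4 (f (inord 0)) (f (inord 1)) (f (inord 2)) (f (inord 3))).
Proof.
apply: alternating_adj => i j f ij.
have [[-> ->]|[-> ->]|[-> ->]] : [\/ i = inord 0 /\ j = inord 1,
    i = inord 1 /\ j = inord 2 | i = inord 2 /\ j = inord 3].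
  case: i ij => -[|[|[|i]]] lti /= ij; [constructor 1|constructor 2|constructor 3|].
  - by split; apply/val_inj; rewrite /= inordK.
  - by split; apply/val_inj; rewrite /= inordK.
  - by split; apply/val_inj; rewrite /= inordK.
  by have := ltn_ord j; rewrite ij.
- by rewrite /= tpermL tpermR !tpermD ?inord_neq // spin4_swap12.
- by rewrite /= tpermL tpermR !tpermD ?inord_neq // spin4_swap23.
by rewrite /= tpermL tpermR !tpermD ?inord_neq // spin4_swap34.
Qed.

Definition gam_alt k (f : 'I_k -> 'I_7) : 'M[A]_8 :=
  (k`!)%:R^-1 *:
    \sum_(t : 'S_k) (-1) ^+ odd_perm t *: \prod_(m < k) gam (f (t m)).

Lemma bform_gam_alt k (f : 'I_k -> 'I_7) :
  bform chi (gam_alt f *m chi) = (k`!)%:R^-1 *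
    \sum_(t : 'S_k) (-1) ^+ odd_perm t *
      bform chi ((\prod_(m < k) gam ((f \o t) m)) *m chi).
Proof.
rewrite /gam_alt -scalemxAl bformZr mulmx_suml bform_sumr; congr (_ * _).
by apply: eq_bigr => t _; rewrite -scalemxAl bformZr.
Qed.

Lemma bform_gam_alt3 (f : 'I_3 -> 'I_7) :
  bform chi (gam_alt f *m chi) = spin3 (f (inord 0)) (f (inord 1)) (f (inord 2)).
Proof.
rewrite bform_gam_alt -[RHS](@alternation_id _ 3 _ _ (nat_unit 5) spin3_alternating).
congr (_ * _); apply: eq_bigr => t _; congr (_ * _).
by rewrite prod_ord3 -!mulmxE -!mulmxA.
Qed.

(* The trace corrections are symmetric under some transposition, so they do not
   contribute to the antisymmetrised product. *)
Lemma bform_gam_alt4 (f : 'I_4 -> 'I_7) :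
  bform chi (gam_alt f *m chi) =
  spin4 (f (inord 0)) (f (inord 1)) (f (inord 2)) (f (inord 3)).
Proof.
pose o k : 'I_4 := inord k.
pose tr i j k l (g : 'I_4 -> 'I_7) := 'd_(g (o i), g (o j)) * 'd_(g (o k), g (o l)).
have tr0 i j k l : (i < j <= 3)%N -> (k <= 3)%N -> (l <= 3)%N ->
    k \notin [:: i; j] -> l \notin [:: i; j] ->
    \sum_(t : 'S_4) (-1) ^+ odd_perm t * tr i j k l (f \o t) = 0.
  move=> /andP[ij j3] k3 l3; rewrite !inE !negb_or => /andP[ki kj] /andP[li lj].
  have i3 : (i <= 3)%N by rewrite (leq_trans (ltnW ij)).
  apply: (@alternation_sym0 _ _ (tr i j k l) (o i) (o j)).
  - exact: (nat_unit 1).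
  - by rewrite inord_neq // neq_ltn ij.
  have tD z : (z <= 3)%N -> z != i -> z != j -> tperm (o i) (o j) (o z) = o z.
    by move=> z3 zi zj; rewrite tpermD // inord_neq // eq_sym.
  by move=> g; rewrite /tr /= tpermL tpermR !tD // (eq_sym (g (o j))).
rewrite bform_gam_alt -[RHS](@alternation_id _ 4 _ _ (nat_unit 23) spin4_alternating).
congr (_ * _).
rewrite (eq_bigr (fun t : 'S_4 => (-1) ^+ odd_perm t *
   spin4 ((f \o t) (o 0)) ((f \o t) (o 1)) ((f \o t) (o 2)) ((f \o t) (o 3)) +
   ((-1) ^+ odd_perm t * tr 0 1 2 3 (f \o t) -
    (-1) ^+ odd_perm t * tr 0 2 1 3 (f \o t) +
    (-1) ^+ odd_perm t * tr 0 3 1 2 (f \o t)))); last first.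
  move=> t _; rewrite prod_ord4 -!mulmxE -!mulmxA -!mulrBr -!mulrDr.
  by congr (_ * _); rewrite /spin4 /tr; ring.
by rewrite big_split /= big_split sumrB /= !tr0 // subr0 !addr0.
Qed.
End Clifford.

(** * Contraction with wedges of coframe elements, which reads off components in the frame *)

Section FlatWedges.
Variable A : comUnitRingType.
Hypothesis nat_unit : forall n, n.+1%:R \is a @GRing.unit A.
Variables E G : 'M[A]_7.
Hypothesis EGE : E *m G *m E^T = 1%:M.

Notation delta_form c := ((fun f => (f ord0 == c)%:R) : kform A 1).
Notation fl c := (flat G (row c E)).

(** Wedging with a coframe element pins the last index of [Q] to [c]; the normalising factorials
    absorb the repetitions. *)
Lemma sum_wedge_delta k (alpha : kform A k) c (Q : kform A (k + 1)) :
  alternating Q ->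
  ((k + 1)`!)%:R^-1 * \sum_(h : {ffun 'I_(k + 1) -> 'I_7})
    wedge alpha (delta_form c) h * Q h =
  (k`!)%:R^-1 *
    \sum_(f : {ffun 'I_k -> 'I_7}) alpha f * Q (fcat f (fun=> c)).
Proof.
move=> altQ; rewrite (sum_wedge_alternating _ _ altQ) invr1 mulr1.
have u : ((k + 1)`!)%:R \is a @GRing.unit A.
  by rewrite -(prednK (fact_gt0 _)) nat_unit.
rewrite mulrA [_^-1 * (_ * _)]mulrCA mulVr // mulr1; congr (_ * _).
apply: eq_bigr => f _; congr (_ * _).
by rewrite (sum_delta1 c (fun g => Q (fcat f g))).
Qed.

Lemma form_pull_wedge_flat k (alpha : kform A k) c :
  form_pull E (wedge alpha (fl c)) = wedge (form_pull E alpha) (delta_form c).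
Proof.
apply/funext => f; rewrite form_pull_wedge; congr (wedge _ _ f).
by apply/funext => g; rewrite form_pull_flat.
Qed.

Lemma sum_delta_form c (Q : kform A 1) :
  (1`!)%:R^-1 * \sum_(h : {ffun 'I_1 -> 'I_7}) form_pull E (fl c) h * Q h =
  Q (fun=> c).
Proof.
rewrite invr1 mul1r -(sum_delta1 c Q); apply: eq_bigr => h _.
by rewrite form_pull_flat.
Qed.

(** The wedge associates to the left, so indices are pinned from the last to the first. With [Q] a
    gamma bilinear this evaluates the Clifford action in the definition of the spinor on frame
    vectors. *)
Lemma sum_flat_wedge3 a b c (Q : kform A 3) : alternating Q ->
  (3`!)%:R^-1 * \sum_(h : {ffun 'I_3 -> 'I_7})
    form_pull E (wedge (wedge (fl a) (fl b)) (fl c)) h * Q h =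
  Q (tnth [tuple a; b; c]).
Proof.
move=> altQ; rewrite !form_pull_wedge_flat.
rewrite (@sum_wedge_delta 2 _ _ _ altQ).
rewrite (@sum_wedge_delta 1 _ _ (fun f => Q (fcat f (fun=> c)))); last first.
  exact: (@alternating_fcatl _ 2 1).
rewrite (sum_delta_form a (fun f => Q (@fcat 2 1 (@fcat 1 1 f (fun=> b)) (fun=> c)))).
congr Q; rewrite -[LHS]tnth3_eta; congr (tnth [tuple _; _; _]).
- rewrite (_ : inord 0 = @lshift 2 1 (@lshift 1 1 ord0)) ?fcat_lshift //.
  by apply/val_inj; rewrite /= inordK.
- rewrite (_ : inord 1 = @lshift 2 1 (@rshift 1 1 ord0)) ?fcat_lshift ?fcat_rshift //.
  by apply/val_inj; rewrite /= inordK.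
rewrite (_ : inord 2 = @rshift 2 1 ord0) ?fcat_rshift //.
by apply/val_inj; rewrite /= inordK.
Qed.

Lemma sum_flat_wedge4 a b c d (Q : kform A 4) : alternating Q ->
  (4`!)%:R^-1 * \sum_(h : {ffun 'I_4 -> 'I_7})
    form_pull E (wedge (wedge (wedge (fl a) (fl b)) (fl c)) (fl d)) h * Q h =
  Q (tnth [tuple a; b; c; d]).
Proof.
move=> altQ; rewrite !form_pull_wedge_flat.
rewrite (@sum_wedge_delta 3 _ _ _ altQ).
have altQ3 : alternating (fun f : 'I_3 -> 'I_7 => Q (@fcat 3 1 f (fun=> d))).
  exact: (@alternating_fcatl _ 3 1).
rewrite (@sum_wedge_delta 2 _ _ _ altQ3).
rewrite (@sum_wedge_delta 1 _ _
  (fun f => Q (@fcat 3 1 (@fcat 2 1 f (fun=> c)) (fun=> d)))); last first.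
  exact: (@alternating_fcatl _ 2 1 _ (fun=> c) altQ3).
rewrite (sum_delta_form a (fun f =>
  Q (@fcat 3 1 (@fcat 2 1 (@fcat 1 1 f (fun=> b)) (fun=> c)) (fun=> d)))).
congr Q; rewrite -[LHS]tnth4_eta; congr (tnth [tuple _; _; _; _]).
- rewrite (_ : inord 0 = @lshift 3 1 (@lshift 2 1 (@lshift 1 1 ord0)))
    ?fcat_lshift //.
  by apply/val_inj; rewrite /= inordK.
- rewrite (_ : inord 1 = @lshift 3 1 (@lshift 2 1 (@rshift 1 1 ord0)))
    ?fcat_lshift ?fcat_rshift //.
  by apply/val_inj; rewrite /= inordK.
- rewrite (_ : inord 2 = @lshift 3 1 (@rshift 2 1 ord0))
    ?fcat_lshift ?fcat_rshift //.
  by apply/val_inj; rewrite /= inordK.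
rewrite (_ : inord 3 = @rshift 3 1 ord0) ?fcat_rshift //.
by apply/val_inj; rewrite /= inordK.
Qed.
End FlatWedges.

(** * The spin connection *)

Section Connection.
Variable A : comUnitRingType.
Hypothesis nat_unit : forall n, n.+1%:R \is a @GRing.unit A.
Variables (gam : 'I_7 -> 'M[A]_8) (B : 'M[A]_8).
Hypothesis gam_clifford : forall a b,
  gam a *m gam b + gam b *m gam a = (- 2%:R * (a == b)%:R)%:M.
Hypothesis B_sym : B^T = B.
Hypothesis B_invariant : forall a, (gam a)^T *m B *m gam a = B.
Variable chi : 'cV[A]_8.
Hypothesis chi_unit : bform B chi chi = 1.

(** For skew [w], the image of [w] under the isomorphism of so(7) with the Lie algebra of
    Spin(7). *)
Definition spin_conn (w : 'M[A]_7) : 'M[A]_8 :=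
  4%:R^-1 *: \sum_b \sum_c w b c *: (gam b *m gam c).

Lemma spin_connE w (v : 'cV[A]_8) : spin_conn w *m v =
  4%:R^-1 *: \sum_b \sum_c w b c *: (gam b *m (gam c *m v)).
Proof.
rewrite /spin_conn -scalemxAl mulmx_suml; congr (_ *: _).
apply: eq_bigr => b _; rewrite mulmx_suml; apply: eq_bigr => c _.
by rewrite -scalemxAl mulmxA.
Qed.

Lemma skew_entry (w : 'M[A]_7) b c : w^T = - w -> w c b = - w b c.
Proof. by move=> /matrixP/(_ b c); rewrite !mxE. Qed.

(** Moving [gam b] through the two gammas yields two contractions of weight 2. Skewness of [w] makes
    them add up to 4, which cancels the prefactor: the commutator rotates the gammas by [w]. *)
Lemma spin_conn_gam w b (v : 'cV[A]_8) : w^T = - w ->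
  spin_conn w *m (gam b *m v) =
  gam b *m (spin_conn w *m v) + \sum_e w b e *: (gam e *m v).
Proof.
move=> skw; rewrite !spin_connE -scalemxAr.
have move_gam e f : w e f *: (gam e *m (gam f *m (gam b *m v))) =
    gam b *m (w e f *: (gam e *m (gam f *m v)))
    + (2%:R * w e f) *: ((b == e)%:R *: (gam f *m v))
    - (2%:R * w e f) *: ((b == f)%:R *: (gam e *m v)).
  rewrite -scalemxAr (gam_swap gam_clifford f b) mulmxDr !mulmxN -scalemxAr.
  rewrite (gam_swap gam_clifford e b) opprD !opprK (eq_sym e) (eq_sym f).
  by rewrite scalerBr scalerDr !scalerA; congr (_ + _ *: _ - _ *: _); ring.
under eq_bigr do under eq_bigr do rewrite move_gam.
under eq_bigr do rewrite sumrB big_split /=.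
rewrite sumrB big_split /= scalerBr scalerDr -addrA; congr (_ + _).
  rewrite mulmx_sumr; congr (_ *: _); apply: eq_bigr => e _.
  by rewrite mulmx_sumr.
rewrite exchange_big /=.
under eq_bigr => f _ do
  (under eq_bigr => e _ do rewrite scalerA mulrC -scalerA; rewrite sum_deltaZ).
under [X in _ - _ *: X]eq_bigr => e _ do
  (under eq_bigr => f _ do rewrite scalerA mulrC -scalerA; rewrite sum_deltaZ).
rewrite -scalerBr -sumrB scaler_sumr; apply: eq_bigr => e _.
rewrite -scalerBl scalerA; congr (_ *: _).
transitivity (4%:R^-1 * 4%:R * w b e); first by rewrite (skew_entry b e skw); ring.
by rewrite (mulVr (nat_unit 3)) mul1r.
Qed.

(** Transposing two gammas restores the sign but reverses their order; exchanging the indices of [w]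
    supplies the minus sign. *)
Lemma bform_spin_conn w x y : w^T = - w ->
  bform B (spin_conn w *m x) y = - bform B x (spin_conn w *m y).
Proof.
move=> skw; rewrite !spin_connE bformZl // bformZr -mulrN; congr (_ * _).
rewrite bformC // !bform_sumr -sumrN.
under eq_bigr do rewrite bform_sumr.
under [RHS]eq_bigr do rewrite bform_sumr -sumrN.
rewrite exchange_big /=; apply: eq_bigr => c _; apply: eq_bigr => b _.
rewrite !bformZr (skew_entry c b skw) mulNr; congr (- (_ * _)).
by rewrite bformC // !(bform_gam nat_unit gam_clifford B_invariant) opprK.
Qed.

Notation spin3 := (spin3 gam B chi).
Notation spin4 := (spin4 gam B chi).
Notation spin_triple := (spin_triple gam B chi).

Lemma spin_tripleD eta eta' b c d :
  spin_triple (eta + eta') b c d = spin_triple eta b c d + spin_triple eta' b c d.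
Proof.
by rewrite /spin_triple bformDl // !mulmxDr bformDr; ring.
Qed.

Lemma spin_tripleZ a eta b c d :
  spin_triple (a *: eta) b c d = a * spin_triple eta b c d.
Proof.
by rewrite /spin_triple bformZl // -!scalemxAr bformZr mulrDr.
Qed.

Lemma spin_triple_sum (I : finType) (eta : I -> 'cV[A]_8) b c d :
  spin_triple (\sum_i eta i) b c d = \sum_i spin_triple (eta i) b c d.
Proof.
rewrite /spin_triple bformC // bform_sumr !mulmx_sumr bform_sumr -big_split.
by apply: eq_bigr => i _ /=; rewrite bformC.
Qed.

(** Infinitesimal Spin(7) equivariance of [spin3]: rotating the spinor amounts to rotating the three
    indices the opposite way. *)
Lemma spin_triple_conn w b c d : w^T = - w ->
  spin_triple (spin_conn w *m chi) b c d =
  - (\sum_e w b e * spin3 e c d + \sum_e w c e * spin3 b e d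
     + \sum_e w d e * spin3 b c e).
Proof.
move=> skw; rewrite /spin_triple bform_spin_conn //.
have Sd : bform B chi (gam b *m (gam c *m \sum_e w d e *: (gam e *m chi))) =
    \sum_e w d e * spin3 b c e.
  rewrite !mulmx_sumr bform_sumr; apply: eq_bigr => e _.
  by rewrite -!scalemxAr bformZr.
have Sc : bform B chi (gam b *m \sum_e w c e *: (gam e *m (gam d *m chi))) =
    \sum_e w c e * spin3 b e d.
  rewrite !mulmx_sumr bform_sumr; apply: eq_bigr => e _.
  by rewrite -!scalemxAr bformZr.
have Sb : bform B chi (\sum_e w b e *: (gam e *m (gam c *m (gam d *m chi)))) =
    \sum_e w b e * spin3 e c d.
  by rewrite bform_sumr; apply: eq_bigr => e _; rewrite bformZr.
rewrite !(spin_conn_gam _ _ skw) !mulmxDr !bformDr Sd Sc Sb; ring.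
Qed.

(** * The Levi-Civita connection at one point, [chr l k j] standing for the symbol with upper index
    k and lower indices l, j *)

Section Metric.
Variables (E G : 'M[A]_7) (dE dG chr : 'I_7 -> 'M[A]_7).
Hypothesis EGE : E *m G *m E^T = 1%:M.
Hypothesis chr_sym : forall l k j, chr l k j = chr j k l.
Hypothesis dG_chr : forall l, dG l = (chr l)^T *m G + G *m chr l.
Hypothesis dEGE : forall l,
  dE l *m G *m E^T + E *m dG l *m E^T + E *m G *m (dE l)^T = 0.
Hypothesis G_sym : G^T = G.

(** The connection matrix: its entry (b, c) is the metric pairing of the covariant derivative of e_b
    along l with e_c. *)
Definition frame_conn l : 'M[A]_7 := (dE l + E *m (chr l)^T) *m G *m E^T.

(** Once [dG l] is written through the Christoffel symbols, the differentiated orthonormality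
    relation is the sum of this matrix and its transpose. *)
Lemma frame_conn_skew l : (frame_conn l)^T = - frame_conn l.
Proof.
apply/eqP; rewrite eq_sym eqr_oppLR -subr_eq0 opprK; apply/eqP.
rewrite -(dEGE l) dG_chr /frame_conn !trmx_mul linearD /= trmx_mul !trmxK G_sym.
by rewrite !mulmxDl !mulmxDr !mulmxDl !mulmxA !addrA addrAC.
Qed.

Lemma frame_conn_frame l : frame_conn l *m E = dE l + E *m (chr l)^T.
Proof.
have GEE : G *m (E^T *m E) = 1%:M.
  by rewrite mulmxA; apply: mulmx1C; rewrite mulmxA.
by rewrite /frame_conn -!mulmxA GEE mulmx1.
Qed.

Definition trilin (U V W : 'I_7 -> A) (t : 'I_7 -> 'I_7 -> 'I_7 -> A) :=
  \sum_a \sum_b \sum_c U a * V b * W c * t a b c.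

Lemma trilin_sum1 (U : 'I_7 -> 'I_7 -> A) x V W t :
  trilin (fun a => \sum_e x e * U e a) V W t = \sum_e x e * trilin (U e) V W t.
Proof.
rewrite /trilin; under [RHS]eq_bigr do rewrite mulr_sumr.
rewrite [RHS]exchange_big /=; apply: eq_bigr => a _.
under [RHS]eq_bigr do rewrite mulr_sumr.
rewrite [RHS]exchange_big /=; apply: eq_bigr => b _.
under [RHS]eq_bigr do rewrite mulr_sumr.
rewrite [RHS]exchange_big /=; apply: eq_bigr => c _.
by rewrite !mulr_suml; apply: eq_bigr => e _; ring.
Qed.

Lemma trilin_swap12 U V W t :
  trilin U V W t = trilin V U W (fun a b c => t b a c).
Proof.
rewrite /trilin exchange_big /=; apply: eq_bigr => b _; apply: eq_bigr => a _.
by apply: eq_bigr => c _; ring.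
Qed.

Lemma trilin_swap13 U V W t :
  trilin U V W t = trilin W V U (fun a b c => t c b a).
Proof.
rewrite /trilin exchange_big /= (eq_bigr _ (fun b _ => exchange_big _ _ _ _ _ _)).
rewrite /= exchange_big /=; apply: eq_bigr => c _; apply: eq_bigr => b _.
by apply: eq_bigr => a _; ring.
Qed.

Lemma trilinB1 U U' V W t :
  trilin (fun a => U a - U' a) V W t = trilin U V W t - trilin U' V W t.
Proof.
rewrite /trilin -sumrB; apply: eq_bigr => a _; rewrite -sumrB.
by apply: eq_bigr => b _; rewrite -sumrB; apply: eq_bigr => c _; ring.
Qed.

(** The coordinate derivative of a frame vector is its rotation by the connection minus a
    Christoffel term. The two parts meet different fates: the first joins the spinor derivative, the
    second cancels. *)
Lemma trilin_frame1 l b V W t :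
  trilin (dE l b) V W t = \sum_e frame_conn l b e * trilin (E e) V W t -
  \sum_k E b k * trilin ((chr l)^~ k) V W t.
Proof.
rewrite -!trilin_sum1 -trilinB1; congr (trilin _ V W t); apply/funext => a.
have /matrixP/(_ b a) := frame_conn_frame l.
rewrite !mxE => ->; rewrite (eq_bigr (fun k => E b k * chr l a k)) ?addrK // => k _.
by rewrite mxE.
Qed.

Lemma trilin_frame2 l U b W t :
  trilin U (dE l b) W t = \sum_e frame_conn l b e * trilin U (E e) W t -
  \sum_k E b k * trilin U ((chr l)^~ k) W t.
Proof.
rewrite trilin_swap12 trilin_frame1; congr (_ - _); apply: eq_bigr => e _;
  by rewrite trilin_swap12.
Qed.

Lemma trilin_frame3 l U V b t :
  trilin U V (dE l b) t = \sum_e frame_conn l b e * trilin U V (E e) t -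
  \sum_k E b k * trilin U V ((chr l)^~ k) t.
Proof.
rewrite trilin_swap13 trilin_frame1; congr (_ - _); apply: eq_bigr => e _;
  by rewrite trilin_swap13.
Qed.

Lemma sum_skew_sym0 (P Q : 'I_7 -> 'I_7 -> A) :
  (forall a b, P b a = - P a b) -> (forall a b, Q b a = Q a b) ->
  \sum_a \sum_b P a b * Q a b = 0.
Proof.
move=> skP symQ; apply: (double_inj nat_unit); rewrite addr0 {2}exchange_big /=.
rewrite -big_split big1 // => a _ /=; rewrite -big_split big1 // => b _ /=.
by rewrite skP symQ mulNr addNr.
Qed.

(** Vanishing torsion makes a Christoffel term symmetric in the derivative index and the index it
    acts on, hence zero against [spin4] by [sum_skew_sym0]. *)
Lemma sum_frame_chr_sym (T : ('I_7 -> A) -> A) m b :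
  \sum_l E m l * (\sum_k E b k * T ((chr l)^~ k)) =
  \sum_l E b l * (\sum_k E m k * T ((chr l)^~ k)).
Proof.
under eq_bigr do rewrite mulr_sumr.
rewrite exchange_big /=; apply: eq_bigr => k _; rewrite mulr_sumr.
apply: eq_bigr => l _; rewrite mulrCA; congr (_ * (_ * T _)).
by apply/funext => a; rewrite chr_sym.
Qed.

Variables (phi : 'I_7 -> 'I_7 -> 'I_7 -> A).
Variables (dphi : 'I_7 -> 'I_7 -> 'I_7 -> 'I_7 -> A) (dchi : 'I_7 -> 'cV[A]_8).
Hypothesis phi_spin : forall b c d, trilin (E b) (E c) (E d) phi = spin3 b c d.
Hypothesis dphi_spin : forall l b c d,
  trilin (dE l b) (E c) (E d) phi + trilin (E b) (dE l c) (E d) phi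
  + trilin (E b) (E c) (dE l d) phi + trilin (E b) (E c) (E d) (dphi l)
  = spin_triple (dchi l) b c d.

Definition cov l := dchi l + spin_conn (frame_conn l) *m chi.

(** The differentiated spinor formula is solved for the derivative of [phi]. By [spin_triple_conn]
    the rotations of the three frame vectors are exactly the connection part of [cov]. *)
Lemma trilin_dphi l b c d :
  trilin (E b) (E c) (E d) (dphi l) = spin_triple (cov l) b c d
  + \sum_k E b k * trilin ((chr l)^~ k) (E c) (E d) phi
  + \sum_k E c k * trilin (E b) ((chr l)^~ k) (E d) phi
  + \sum_k E d k * trilin (E b) (E c) ((chr l)^~ k) phi.
Proof.
rewrite /cov spin_tripleD spin_triple_conn ?frame_conn_skew // -dphi_spin.
rewrite trilin_frame1 trilin_frame2 trilin_frame3.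
under [X in _ - (X + _ + _)]eq_bigr do rewrite -phi_spin.
under [X in _ - (_ + X + _)]eq_bigr do rewrite -phi_spin.
under [X in _ - (_ + _ + X)]eq_bigr do rewrite -phi_spin.
ring.
Qed.

Lemma spin4_dphi :
  \sum_m \sum_b \sum_c \sum_d spin4 m b c d *
    \sum_l E m l * trilin (E b) (E c) (E d) (dphi l) =
  48%:R * \sum_m bform B chi (gam m *m \sum_l E m l *: cov l).
Proof.
pose N1 m b c d := \sum_l E m l *
  \sum_k E b k * trilin ((chr l)^~ k) (E c) (E d) phi.
pose N2 m b c d := \sum_l E m l *
  \sum_k E c k * trilin (E b) ((chr l)^~ k) (E d) phi.
pose N3 m b c d := \sum_l E m l *
  \sum_k E d k * trilin (E b) (E c) ((chr l)^~ k) phi.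
have split_term m b c d : spin4 m b c d *
    (\sum_l E m l * trilin (E b) (E c) (E d) (dphi l)) =
    spin4 m b c d * spin_triple (\sum_l E m l *: cov l) b c d +
    spin4 m b c d * N1 m b c d + spin4 m b c d * N2 m b c d +
    spin4 m b c d * N3 m b c d.
  rewrite -!mulrDr spin_triple_sum /N1 /N2 /N3 -!big_split; congr (_ * _).
  by apply: eq_bigr => l _; rewrite trilin_dphi spin_tripleZ !mulrDr.
have sum_split (I : finType) (F1 F2 F3 F4 : I -> A) :
    \sum_i (F1 i + F2 i + F3 i + F4 i) =
    \sum_i F1 i + \sum_i F2 i + \sum_i F3 i + \sum_i F4 i.
  by rewrite !big_split.
under eq_bigr do under eq_bigr do under eq_bigr do under eq_bigr do rewrite split_term.
under eq_bigr do under eq_bigr do under eq_bigr do rewrite sum_split.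
under eq_bigr do under eq_bigr do rewrite sum_split.
under eq_bigr do rewrite sum_split.
rewrite sum_split.
have -> : \sum_m \sum_b \sum_c \sum_d spin4 m b c d * N1 m b c d = 0.
  under eq_bigr do rewrite exchange_big /=.
  rewrite exchange_big big1 // => c _ /=.
  under eq_bigr do rewrite exchange_big /=.
  rewrite exchange_big big1 // => d _ /=.
  apply: sum_skew_sym0 => m b; first exact: spin4_swap12.
  exact: (sum_frame_chr_sym (fun u => trilin u (E c) (E d) phi)).
have -> : \sum_m \sum_b \sum_c \sum_d spin4 m b c d * N2 m b c d = 0.
  rewrite exchange_big big1 // => b _ /=.
  under eq_bigr do rewrite exchange_big /=.
  rewrite exchange_big big1 // => d _ /=.
  apply: sum_skew_sym0 => m c.
    by rewrite spin4_swap23 // spin4_swap12 // spin4_swap23 // !opprK.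
  exact: (sum_frame_chr_sym (fun u => trilin (E b) u (E d) phi)).
have -> : \sum_m \sum_b \sum_c \sum_d spin4 m b c d * N3 m b c d = 0.
  rewrite exchange_big big1 // => b _ /=.
  rewrite exchange_big big1 // => c _ /=.
  apply: sum_skew_sym0 => m d.
    (* The exchange of the first and fourth index is a product of five adjacent swaps, hence odd. *)
    rewrite spin4_swap12 // spin4_swap23 // spin4_swap34 // spin4_swap23 //.
    by rewrite spin4_swap12 // !opprK.
  exact: (sum_frame_chr_sym (fun u => trilin (E b) (E c) u phi)).
rewrite !addr0 mulr_sumr; apply: eq_bigr => m _; exact: spin4_triple.
Qed.
End Metric.
End Connection.

(** * Contraction of an exterior derivative with an alternating four-form *)

Section ExteriorDerivative.
Variable A : comUnitRingType.

Lemma form_pull_alternating k E (alpha : kform A k) :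
  alternating alpha -> alternating (form_pull E alpha).
Proof.
move=> alta t f; rewrite !form_pullE mulr_sumr.
rewrite (reindex_inj (h := fun h : {ffun 'I_k -> 'I_7} => [ffun i => h (t i)])) /=;
  last first.
  move=> h h' /ffunP hh; apply/ffunP => i.
  by have := hh (t^-1%g i); rewrite !ffunE permKV.
apply: eq_bigr => h _; rewrite (ffun_eta (fun i => h (t i))) (alta t h) mulrCA.
congr (_ * (_ * _)); rewrite [RHS](reindex_inj (@perm_inj _ t)) /=.
by apply: eq_bigr => m _.
Qed.

Variable E : 'M[A]_7.

(** Pullback along [E^T] is adjoint to pullback along [E], so the frame can be moved to the other
    factor and back. *)
Lemma sum_form_pull_mul k (alpha beta : kform A k) :
  \sum_(f : {ffun 'I_k -> 'I_7}) form_pull E alpha f * beta f =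
  \sum_(f : {ffun 'I_k -> 'I_7}) alpha f * form_pull E^T beta f.
Proof.
under eq_bigr do rewrite form_pullE mulr_suml.
rewrite exchange_big /=; apply: eq_bigr => h _; rewrite form_pullE mulr_sumr.
apply: eq_bigr => f _; rewrite mulrCA mulrA; congr (_ * _ * _).
by apply: eq_bigr => m _; rewrite mxE.
Qed.

(** The formula of [ext_deriv] with the partial derivatives as free data; it unfolds to [ext_deriv]
    when these come from [phi]. *)
Definition alt_deriv (dp : 'I_7 -> kform A 3) : kform A 4 := fun f =>
  \sum_(j < 4) (-1) ^+ j * dp (f j) (fun m => f (lift j m)).

(** The permutation moving slot j to the front has sign (-1)^j, so against an alternating form the
    four terms are equal. *)
Lemma sum_alt_deriv (dp : 'I_7 -> kform A 3) (Y : kform A 4) : alternating Y ->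
  \sum_(f : {ffun 'I_4 -> 'I_7}) alt_deriv dp f * Y f =
  4%:R * \sum_(f : {ffun 'I_4 -> 'I_7})
    dp (f ord0) (fun m => f (lift ord0 m)) * Y f.
Proof.
move=> altY; rewrite /alt_deriv; under eq_bigr do rewrite mulr_suml.
rewrite exchange_big /= (eq_bigr (fun=> \sum_(f : {ffun 'I_4 -> 'I_7})
    dp (f ord0) (fun m => f (lift ord0 m)) * Y f)).
  by rewrite sumr_const card_ord mulr_natl.
move=> j _; pose t : 'S_4 := lift_perm ord0 j 1%g.
rewrite [RHS](reindex_inj (h := fun h : {ffun 'I_4 -> 'I_7} => [ffun i => h (t i)])) /=;
  last first.
  move=> h h' /ffunP hh; apply/ffunP => i.
  by have := hh (t^-1%g i); rewrite !ffunE permKV.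
apply: eq_bigr => f _; rewrite (ffun_eta (fun i => f (t i))) (altY t f).
rewrite odd_lift_perm odd_perm1 addbF /= lift_perm_id.
rewrite (_ : (fun m => f (t (lift ord0 m))) = fun m => f (lift j m)); last first.
  by apply/funext => m; rewrite lift_perm_lift perm1.
by rewrite -[in LHS](signr_odd _ j) [RHS]mulrCA mulrA.
Qed.

Lemma pull_alt_deriv (dp : 'I_7 -> kform A 3) (X : kform A 4) : alternating X ->
  \sum_(k : {ffun 'I_4 -> 'I_7}) form_pull E (alt_deriv dp) k * X k =
  4%:R * \sum_m \sum_b \sum_c \sum_d X (tnth [tuple m; b; c; d]) *
    \sum_l E m l * trilin (E b) (E c) (E d)
      (fun a1 a2 a3 => dp l (tnth [tuple a1; a2; a3])).
Proof.
move=> altX; rewrite sum_form_pull_mul sum_alt_deriv; last first.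
  exact: form_pull_alternating.
congr (_ * _); pose dp0 : kform A 4 := fun f => dp (f ord0) (fun m => f (lift ord0 m)).
rewrite -(sum_form_pull_mul dp0).
rewrite (sum_ffun4 (fun k => form_pull E dp0 k * X k)).
apply: eq_bigr => m _; apply: eq_bigr => b _; apply: eq_bigr => c _.
apply: eq_bigr => d _; rewrite mulrC; congr (_ * _); rewrite form_pullE.
rewrite (sum_ffun4 (fun h => (\prod_i E (tnth [tuple m; b; c; d] i) (h i)) * dp0 h)).
apply: eq_bigr => l _; rewrite /trilin mulr_sumr; apply: eq_bigr => a1 _.
rewrite mulr_sumr; apply: eq_bigr => a2 _; rewrite mulr_sumr.
apply: eq_bigr => a3 _; rewrite prod_ord4 !tnth4E /dp0.
rewrite (_ : tnth _ ord0 = l) //.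
rewrite (_ : (fun i => _) = tnth [tuple a1; a2; a3]); first by rewrite !mulrA.
apply/funext => -[[|[|[|//]]] p]; by rewrite !(tnth_nth ord0).
Qed.
End ExteriorDerivative.

(** * Partial derivatives of dual-valued functions *)

Section PartialDerivative.
Variables (R : realType) (Y : topologicalType) (M : manifold7 R Y).
Notation D := (dual R).
Variables (i : chart M) (y : Y).
Hypothesis iy : Defs.dom i y.
Variable l : 'I_7.

(** The derivative operator is total, so its value alone does not support the sum and product rules;
    differentiability is carried along with it. *)
Definition has_partial_real (f : Y -> R) (d : R) :=
  differentiable (f \o param i) (coord i y) /\ partial_real i l f y = d.

Definition has_partial (f : Y -> D) (d : D) :=
  has_partial_real (@dre R \o f) (dre d) /\
  has_partial_real (@deps R \o f) (deps d).

Lemma has_partial_realD f g df dg : has_partial_real f df ->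
  has_partial_real g dg -> has_partial_real (fun z => f z + g z) (df + dg).
Proof.
move=> [cf <-] [cg <-]; split; first exact: differentiableD.
by rewrite /partial_real -deriveD //; exact: diff_derivable.
Qed.

Lemma has_partial_realM f g df dg : has_partial_real f df ->
  has_partial_real g dg -> has_partial_real (fun z => f z * g z) (df * g y + f y * dg).
Proof.
move=> [cf <-] [cg <-]; split; first exact: differentiableM.
rewrite /partial_real; have := @deriveM _ _ (f \o param i) (g \o param i)
  (coord i y) (delta_mx 0 l) (diff_derivable cf) (diff_derivable cg).
rewrite /= coordK // => fgE.
rewrite (_ : (fun z => f z * g z) \o param i = (f \o param i) * (g \o param i)) //.
rewrite fgE addrC.
by rewrite [in RHS]mulrC.
Qed.

Lemma has_partial_cst c : has_partial (fun=> c) 0.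
Proof.
by split; split; [exact: differentiable_cst|exact: derive_cst|
  exact: differentiable_cst|exact: derive_cst].
Qed.

Lemma has_partialD f g df dg : has_partial f df -> has_partial g dg ->
  has_partial (fun z => f z + g z) (df + dg).
Proof. by move=> [f0 f1] [g0 g1]; split; exact: has_partial_realD. Qed.

Lemma has_partialM f g df dg : has_partial f df -> has_partial g dg ->
  has_partial (fun z => f z * g z) (df * g y + f y * dg).
Proof.
move=> [f0 f1] [g0 g1]; split; first exact: has_partial_realM.
have := has_partial_realD (has_partial_realM f0 g1) (has_partial_realM f1 g0).
congr has_partial_real => /=; ring.
Qed.

Lemma has_partial_sum (I : Type) (r : seq I) (f : I -> Y -> D) (df : I -> D) :
  (forall j, has_partial (f j) (df j)) ->
  has_partial (fun z => \sum_(j <- r) f j z) (\sum_(j <- r) df j).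
Proof.
move=> fP; elim: r => [|j r IHr].
  rewrite big_nil (_ : (fun=> _) = fun=> 0); first exact: has_partial_cst.
  by apply/funext => z; rewrite big_nil.
rewrite big_cons (_ : (fun=> _) = fun z => f j z + \sum_(j <- r) f j z).
  exact: has_partialD.
by apply/funext => z; rewrite big_cons.
Qed.

Lemma has_partialP f d : has_partial f d -> partial_dual i l f y = d.
Proof. by move=> [[_ f0] [_ f1]]; apply: dual_eq. Qed.

Lemma smooth_dual_partial U f : U y -> smooth_dual M U f ->
  has_partial f (partial_dual i l f y).
Proof.
move=> Uy [f0 f1]; split; split => //.
- by apply: (f0 i [::]); exists y.
by apply: (f1 i [::]); exists y.
Qed.

(** The frame identities hold only where a spin patch meets a chart domain. Continuity of [param]
    turns this into agreement near the coordinate point, which determines the derivative. *)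
Lemma has_partial_local (U : set Y) f g d : open U -> U y ->
  (forall z, U z -> Defs.dom i z -> f z = g z) ->
  has_partial f d -> partial_dual i l g y = d.
Proof.
move=> oU Uy fg /has_partialP <-.
have near_fg : \forall x \near coord i y, f (param i x) = g (param i x).
  have oUi : nbhs y (U `&` Defs.dom i).
    by apply: open_nbhs_nbhs; split => //; apply: openI => //; exact: dom_open.
  have ci : {for coord i y, continuous (param i)}.
    by apply: param_continuous; exists y.
  have := ci (U `&` Defs.dom i); rewrite /= coordK // => /(_ oUi) nUi.
  have {}nUi : \forall x \near coord i y, (U `&` Defs.dom i) (param i x) by [].
  by apply: filterS nUi => x [Ux ix]; exact: fg.
by apply: dual_eq; rewrite /= /partial_real; apply: near_eq_derive;
  apply: filterS near_fg => x /= ->.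
Qed.

(** The value stays existential, since the derivative of the dilaton factor will multiply a
    vanishing bilinear. *)
Lemma has_partial_exp f d : has_partial f d ->
  exists d', has_partial (fun z => dual_exp (f z)) d'.
Proof.
move=> [[d0 _] f1].
have de : differentiable (expR \o (@dre R \o f \o param i)) (coord i y).
  by apply: differentiable_comp => //; apply/derivable1_diffP; exact: derivable_expR.
pose d0' := partial_real i l (expR \o (@dre R \o f)) y.
have e0 : has_partial_real (expR \o (@dre R \o f)) d0' by [].
have e1 := has_partial_realM e0 f1.
by eexists (Dual _ _); split; [exact: e0|exact: e1].
Qed.
End PartialDerivative.

Section DualConst.
Variable R : realType.
Notation D := (dual R).

Lemma dual_const_is_zmod_morphism : zmod_morphism (@dual_const R).
Proof. by move=> a b; apply: dual_eq => //=; rewrite subrr. Qed.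
Lemma dual_const_is_monoid_morphism : monoid_morphism (@dual_const R).
Proof.
by split => // a b; apply: dual_eq => //=; rewrite mulr0 mul0r addr0.
Qed.
HB.instance Definition _ := GRing.isZmodMorphism.Build R D (@dual_const R)
  dual_const_is_zmod_morphism.
HB.instance Definition _ := GRing.isMonoidMorphism.Build R D (@dual_const R)
  dual_const_is_monoid_morphism.

Lemma dual_nat_unit n : n.+1%:R \is a @GRing.unit D.
Proof. by rewrite -(rmorph_nat (@dual_const R)) rmorph_unit // unitfE pnatr_eq0. Qed.

Lemma dual_expD (a b : D) : dual_exp (a + b) = dual_exp a * dual_exp b.
Proof. by apply: dual_eq; rewrite /= expRD //; ring. Qed.

Variable S : spinor_module R.
Notation B := (map_mx (@dual_const R) (pairing S)).

Lemma dgamma_clifford a b :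
  dgamma S a *m dgamma S b + dgamma S b *m dgamma S a =
  (- 2%:R * (a == b)%:R)%:M.
Proof.
rewrite /dgamma -!map_mxM -map_mxD gamma_clifford map_scalar_mx.
by rewrite rmorphM rmorphN !rmorph_nat.
Qed.

Lemma dual_pairing_sym : B^T = B.
Proof. by rewrite map_trmx pairing_sym. Qed.

Lemma dual_pairing_invariant a : (dgamma S a)^T *m B *m dgamma S a = B.
Proof. by rewrite /dgamma map_trmx -!map_mxM pairing_invariant. Qed.
End DualConst.

(** * Leibniz rules for matrix-valued functions and for the bilinears *)

Section MatrixPartial.
Variables (R : realType) (Y : topologicalType) (M : manifold7 R Y).
Notation D := (dual R).
Variables (i : chart M) (y : Y).
Hypothesis iy : Defs.dom i y.
Variable l : 'I_7.

Definition has_partial_mx m n (X : Y -> 'M[D]_(m, n)) (dX : 'M[D]_(m, n)) :=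
  forall a b, has_partial i y l (fun z => X z a b) (dX a b).

Lemma has_partial_mx_cst m n (X : 'M[D]_(m, n)) : has_partial_mx (fun=> X) 0.
Proof. by move=> a b; rewrite mxE; exact: has_partial_cst. Qed.

Lemma has_partial_mx_tr m n (X : Y -> 'M[D]_(m, n)) dX :
  has_partial_mx X dX -> has_partial_mx (fun z => (X z)^T) dX^T.
Proof.
move=> XP a b; rewrite mxE (_ : (fun _ => _) = fun z => X z b a) //.
by apply/funext => z; rewrite mxE.
Qed.

Lemma has_partial_mxM m n q (X : Y -> 'M[D]_(m, n)) (Z : Y -> 'M[D]_(n, q)) dX dZ :
  has_partial_mx X dX -> has_partial_mx Z dZ ->
  has_partial_mx (fun z => X z *m Z z) (dX *m Z y + X y *m dZ).
Proof.
move=> XP ZP a b; rewrite !mxE -big_split /=.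
rewrite (_ : (fun _ => _) = fun z => \sum_j X z a j * Z z j b); last first.
  by apply/funext => z; rewrite mxE.
by apply: has_partial_sum => j; exact: has_partialM.
Qed.

Lemma has_partial_bform (B : 'M[D]_8) (x z : Y -> 'cV[D]_8) dx dz :
  has_partial_mx x dx -> has_partial_mx z dz ->
  has_partial i y l (fun t => bform B (x t) (z t)) (bform B dx (z y) + bform B (x y) dz).
Proof.
move=> xP zP; have := has_partial_mxM
  (has_partial_mxM (has_partial_mx_tr xP) (has_partial_mx_cst B)) zP.
by move=> /(_ 0 0); rewrite mulmx0 addr0 [X in has_partial _ _ _ _ X]mxE.
Qed.

Lemma has_partial_mulmx_cst n q m (X : 'M[D]_(m, n)) (Z : Y -> 'M[D]_(n, q)) dZ :
  has_partial_mx Z dZ -> has_partial_mx (fun z => X *m Z z) (X *m dZ).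
Proof.
by move=> ZP; have := has_partial_mxM (has_partial_mx_cst X) ZP; rewrite mul0mx add0r.
Qed.

Lemma has_partial_spin3 (gam : 'I_7 -> 'M[D]_8) (B : 'M[D]_8) chi dchi b c d :
  has_partial_mx chi dchi ->
  has_partial i y l (fun z => spin3 gam B (chi z) b c d)
    (spin_triple gam B (chi y) dchi b c d).
Proof.
by move=> chiP; apply: has_partial_bform => //; do 3!apply: has_partial_mulmx_cst.
Qed.

Lemma has_partial_trilin (U V W : Y -> 'I_7 -> D) dU dV dW
    (t : Y -> 'I_7 -> 'I_7 -> 'I_7 -> D) dt :
  (forall a, has_partial i y l (fun z => U z a) (dU a)) ->
  (forall a, has_partial i y l (fun z => V z a) (dV a)) ->
  (forall a, has_partial i y l (fun z => W z a) (dW a)) ->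
  (forall a b c, has_partial i y l (fun z => t z a b c) (dt a b c)) ->
  has_partial i y l (fun z => trilin (U z) (V z) (W z) (t z))
    (trilin dU (V y) (W y) (t y) + trilin (U y) dV (W y) (t y)
     + trilin (U y) (V y) dW (t y) + trilin (U y) (V y) (W y) dt).
Proof.
move=> UP VP WP tP.
rewrite /trilin -!big_split /=; apply: has_partial_sum => a.
rewrite -!big_split /=; apply: has_partial_sum => b.
rewrite -!big_split /=; apply: has_partial_sum => c.
have := has_partialM iy (has_partialM iy (has_partialM iy (UP a) (VP b)) (WP c)) (tP a b c).
congr has_partial; ring.
Qed.
End MatrixPartial.

(** * The density at a point *)

Section Pointwise.
Variables (R : realType) (Y : topologicalType) (M : manifold7 R Y).
Notation D := (dual R).
Variables (S : spinor_module R) (H phi : form_field M 3).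
Variables (G : chart M -> Y -> 'M[D]_7) (s : chart M -> Y -> D).
Variables (P : spin_structure S G s) (chi : spinor_field P).
Notation psi := ((fun i y => hodge3 (G i y) (s i y) (phi i y)) : form_field M 4).
Hypothesis chi_spinor : determines_spinor phi psi chi.

Notation gam := (dgamma S).
Notation B := (map_mx (@dual_const R) (pairing S)).
Let nat_unit := @dual_nat_unit R.
Let gam_cl := @dgamma_clifford R S.
Let B_sym := @dual_pairing_sym R S.
Let B_inv := @dual_pairing_invariant R S.

Variables (p : spin_patch P) (i : chart M).
Notation U := (pdom p `&` Defs.dom i).

Lemma row_tuple3 (E : 'M[D]_7) a b c :
  tnth [tuple row a E; row b E; row c E] = fun m => row (tnth [tuple a; b; c] m) E.
Proof. by apply/funext => -[[|[|[|//]]] m]; rewrite !(tnth_nth 0). Qed.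

Lemma row_tuple4 (E : 'M[D]_7) a b c d :
  tnth [tuple row a E; row b E; row c E; row d E] =
  fun m => row (tnth [tuple a; b; c; d] m) E.
Proof. by apply/funext => -[[|[|[|[|//]]]] m]; rewrite !(tnth_nth 0). Qed.

Lemma bform_clifford k (E : 'M[D]_7) (alpha : kform D k) (x : 'cV[D]_8) :
  bform B x (clifford S E alpha *m x) = (k`!)%:R^-1 *
  \sum_(h : {ffun 'I_k -> 'I_7}) form_pull E alpha h * bform B x (gam_alt gam h *m x).
Proof.
rewrite /clifford -scalemxAl bformZr mulmx_suml bform_sumr; congr (_ * _).
by apply: eq_bigr => h _; rewrite -scalemxAl bformZr.
Qed.

Lemma spinor_pairE (x w : 'cV[D]_8) : spinor_pair S x w = bform B x w.
Proof. by []. Qed.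

Section AtPoint.
Variable z : Y.
Hypothesis Uz : U z.
Notation E := (frame p i z).
Notation x := (chi p z).

Lemma chi_unit : bform B x x = 1.
Proof. by case: chi_spinor => _ /(_ p i z Uz.1 Uz.2) []. Qed.

Lemma frame_EGE : E *m G i z *m E^T = 1%:M.
Proof. exact: frame_orthonormal Uz.1 Uz.2. Qed.

Notation phi_frame := (form_pull E (phi i z)).

(** The defining formula of the spinor is evaluated on frame vectors, whose flats form the dual
    coframe. *)
Lemma phi_frame_spin b c d :
  phi_frame (tnth [tuple b; c; d]) = spin3 gam B x b c d.
Proof.
have [_ /(_ p i z Uz.1 Uz.2) [_ phiE _]] := chi_spinor.
rewrite /form_pull -row_tuple3 phiE spinor_pairE bform_clifford.
have altQ := spin3_alternating nat_unit gam_cl B_sym B_inv x.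
under eq_bigr do rewrite (bform_gam_alt3 nat_unit gam_cl B_sym B_inv).
by rewrite (sum_flat_wedge3 nat_unit frame_EGE b c d altQ) !tnth3E.
Qed.

Lemma psi_frame_spin a b c d :
  form_pull E (psi i z) (tnth [tuple a; b; c; d]) = - spin4 gam B x a b c d.
Proof.
have [_ /(_ p i z Uz.1 Uz.2) [_ _ psiE]] := chi_spinor.
rewrite /form_pull -row_tuple4 psiE spinor_pairE bform_clifford.
have altQ := spin4_alternating nat_unit gam_cl B_sym B_inv chi_unit.
under eq_bigr do rewrite (bform_gam_alt4 nat_unit gam_cl B_sym B_inv chi_unit).
by rewrite (sum_flat_wedge4 nat_unit frame_EGE a b c d altQ) !tnth4E.
Qed.

Lemma phi_frame_alt : phi_frame = fun f : 'I_3 -> 'I_7 =>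
  spin3 gam B x (f (inord 0)) (f (inord 1)) (f (inord 2)).
Proof. by apply/funext => f; rewrite -phi_frame_spin tnth3_eta. Qed.

Lemma psi_frame_alt : form_pull E (psi i z) = fun f : 'I_4 -> 'I_7 =>
  - spin4 gam B x (f (inord 0)) (f (inord 1)) (f (inord 2)) (f (inord 3)).
Proof. by apply/funext => f; rewrite -psi_frame_spin tnth4_eta. Qed.

(** The second description of [psi] in the frame. The flux term relies on this one; the exterior
    derivative term combines it with [psi_frame_alt]. *)
Lemma psi_frame_star : form_pull E (psi i z) = flat_star phi_frame.
Proof.
apply/funext => f; apply: form_pull_hodge3; first exact: frame_EGE.
exact: frame_oriented Uz.1 Uz.2.
Qed.

(** Passing to the frame costs the determinant of [E], the inverse of [s]. There the wedge is the
    full contraction of [H] with [phi], whose components are the three-gamma bilinears occurring in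
    [clifford]. *)
Lemma flux_density : top_coef (wedge (H i z) (psi i z)) =
  s i z * bform B x (clifford S E (H i z) *m x).
Proof.
have altQ := spin3_alternating nat_unit gam_cl B_sym B_inv x.
rewrite -[LHS]mul1r -(frame_oriented Uz.1 Uz.2) -mulrA -top_wedge34_pull.
congr (_ * _); rewrite psi_frame_star top_wedge_flat_star //; last first.
  by rewrite phi_frame_alt.
rewrite bform_clifford.
under [in RHS]eq_bigr do rewrite (bform_gam_alt3 nat_unit gam_cl B_sym B_inv).
by rewrite phi_frame_alt.
Qed.
End AtPoint.
End Pointwise.

(** Here [d] plays the derivative of a scalar factor, [e] the factor itself and [n] the covariant
    derivative of the spinor; orthogonality removes [d]. *)
Lemma bform_orth_combination (A : comUnitRingType) (B g : 'M[A]_8)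
    (x n : 'cV[A]_8) (a d e : A) : bform B x (g *m x) = 0 ->
  bform B x (a *: (g *m (d *: x + e *: n))) = e * bform B x (g *m (a *: n)).
Proof.
move=> gx0; rewrite mulmxDr -!scalemxAr !(bformZr, bformDr) gx0.
by rewrite mulr0 add0r mulrCA.
Qed.

Section PointwiseDerivative.
Variables (R : realType) (Y : topologicalType) (M : manifold7 R Y).
Notation D := (dual R).
Variables (S : spinor_module R) (phi : form_field M 3).
Variables (G : chart M -> Y -> 'M[D]_7) (s : chart M -> Y -> D).
Variables (P : spin_structure S G s) (chi : spinor_field P).
Notation psi := ((fun i y => hodge3 (G i y) (s i y) (phi i y)) : form_field M 4).
Hypothesis phi_field : is_form_field phi.
Hypothesis G_metric : determines_metric phi G s.
Hypothesis chi_spinor : determines_spinor phi psi chi.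

Notation gam := (dgamma S).
Notation B := (map_mx (@dual_const R) (pairing S)).
Let nat_unit := @dual_nat_unit R.
Let gam_cl := @dgamma_clifford R S.
Let B_sym := @dual_pairing_sym R S.
Let B_inv := @dual_pairing_invariant R S.

Variables (p : spin_patch P) (i : chart M) (y : Y).
Notation U := (pdom p `&` Defs.dom i).
Hypothesis Uy : U y.
Let iy : Defs.dom i y := Uy.2.
Notation E := (frame p i y).
Notation x := (chi p y).

Definition frame_diff l : 'M[D]_7 :=
  \matrix_(b, k) partial_dual i l (fun z => frame p i z b k) y.
Definition metric_diff l : 'M[D]_7 :=
  \matrix_(a, b) partial_dual i l (fun z => G i z a b) y.
Definition christoffel_mx l : 'M[D]_7 := \matrix_(k, j) christoffel G i y k l j.
Definition spinor_diff l : 'cV[D]_8 :=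
  \col_m partial_dual i l (fun z => chi p z m 0) y.
Definition phi_diff l a b c : D :=
  partial_dual i l (fun z => phi i z (tnth [tuple a; b; c])) y.

Lemma open_overlap : open U.
Proof. by apply: openI; [exact: pdom_open|exact: dom_open]. Qed.

Lemma G_symmetric z : Defs.dom i z -> (G i z)^T = G i z.
Proof. by case: G_metric => _ _ /(_ i z) GE /GE[]. Qed.

Lemma frame_partial l : has_partial_mx i y l (fun z => frame p i z) (frame_diff l).
Proof.
move=> a b; rewrite mxE; apply: (smooth_dual_partial iy _ Uy).
exact: frame_smooth.
Qed.

Lemma metric_partial l : has_partial_mx i y l (fun z => G i z) (metric_diff l).
Proof.
move=> a b; rewrite mxE; apply: (smooth_dual_partial iy _ iy).
by case: G_metric => + _ _; apply.
Qed.

Lemma spinor_partial l : has_partial_mx i y l (chi p) (spinor_diff l).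
Proof.
move=> a b; rewrite (ord1 b) mxE; apply: (smooth_dual_partial iy _ Uy.1).
by case: chi_spinor => -[+ _] _; apply.
Qed.

Lemma phi_partial l a b c : has_partial i y l
  (fun z => phi i z (tnth [tuple a; b; c])) (phi_diff l a b c).
Proof.
apply: (smooth_dual_partial iy _ iy).
by case: phi_field => _ + _; apply.
Qed.

Lemma frame_metric_diff l :
  frame_diff l *m G i y *m E^T + E *m metric_diff l *m E^T
  + E *m G i y *m (frame_diff l)^T = 0.
Proof.
have EGEP := has_partial_mxM iy (has_partial_mxM iy (frame_partial l)
  (metric_partial l)) (has_partial_mx_tr (frame_partial l)).
rewrite mulmxDl in EGEP; apply/matrixP => a b; rewrite [RHS]mxE.
rewrite -(has_partialP (EGEP a b)).
apply: (has_partial_local iy open_overlap Uy _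
  (has_partial_cst i y l ((1%:M : 'M[D]_7) a b))).
by move=> z [pz _] iz; rewrite frame_orthonormal.
Qed.

Lemma metric_diff_sym l : (metric_diff l)^T = metric_diff l.
Proof.
apply/matrixP => a b; rewrite mxE -[LHS](has_partialP (metric_partial l b a)).
apply: (has_partial_local iy (dom_open i) iy _ (metric_partial l a b)).
by move=> z iz _; rewrite -{1}(G_symmetric iz) mxE.
Qed.

Lemma christoffel_sym l k j : christoffel_mx l k j = christoffel_mx j k l.
Proof.
rewrite !mxE /christoffel; congr (_ * _); apply: eq_bigr => m _; congr (_ * _).
rewrite [X in X - _]addrC; congr (_ - _).
by have /matrixP/(_ l j) := metric_diff_sym m; rewrite !mxE.
Qed.

Lemma metric_compat l :
  metric_diff l = (christoffel_mx l)^T *m G i y + G i y *m christoffel_mx l.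
Proof.
have EGE := frame_EGE Uy.
have uG : G i y \in unitmx.
  have EGEr : E *m (G i y *m E^T) = 1%:M by rewrite mulmxA.
  have GEE : G i y *m (E^T *m E) = 1%:M by rewrite mulmxA (mulmx1C EGEr).
  by have [] := mulmx1_unit GEE.
(* [K] collects the Christoffel symbols of the first kind. Lowering the index turns the claim into
   [K^T] + [K] = [metric_diff l], where all but two equal terms cancel. *)
pose K : 'M[D]_7 := \matrix_(m, j) (2%:R^-1 *
  (metric_diff l j m + metric_diff j l m - metric_diff m l j)).
have chrE : christoffel_mx l = invmx (G i y) *m K.
  apply/matrixP => k j; rewrite !mxE /christoffel mulr_sumr.
  by apply: eq_bigr => m _; rewrite !mxE mulrCA.
have GchrE : G i y *m christoffel_mx l = K by rewrite chrE mulKVmx.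
rewrite GchrE -[X in _ *m X](G_symmetric iy) -trmx_mul GchrE.
apply/matrixP => a b; rewrite [in RHS]mxE [K^T _ _]mxE [K b a]mxE [K a b]mxE.
have sym m c d : metric_diff m c d = metric_diff m d c.
  by rewrite -[in LHS]metric_diff_sym mxE.
rewrite (sym l b a) -mulrDr -[LHS](mulKr (nat_unit 1)); congr (_ * _).
move: (metric_diff l a b) (metric_diff a l b) (metric_diff b l a) => u v w; ring.
Qed.

Lemma form_pull_trilin z b c d :
  form_pull (frame p i z) (phi i z) (tnth [tuple b; c; d]) =
  trilin (frame p i z b) (frame p i z c) (frame p i z d)
    (fun a1 a2 a3 => phi i z (tnth [tuple a1; a2; a3])).
Proof.
rewrite form_pullE (sum_ffun3 (fun h => (\prod_m frame p i z
  (tnth [tuple b; c; d] m) (h m)) * phi i z h)).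
apply: eq_bigr => a1 _; apply: eq_bigr => a2 _; apply: eq_bigr => a3 _.
by rewrite prod_ord3 !tnth3E mulrA.
Qed.

Lemma phi_spin z b c d : U z ->
  trilin (frame p i z b) (frame p i z c) (frame p i z d)
    (fun a1 a2 a3 => phi i z (tnth [tuple a1; a2; a3])) =
  spin3 gam B (chi p z) b c d.
Proof. by move=> Uz; rewrite -form_pull_trilin; exact: (phi_frame_spin chi_spinor Uz). Qed.

Lemma phi_diff_spin l b c d (t := fun a1 a2 a3 => phi i y (tnth [tuple a1; a2; a3])) :
  trilin (frame_diff l b) (E c) (E d) t + trilin (E b) (frame_diff l c) (E d) t
  + trilin (E b) (E c) (frame_diff l d) t + trilin (E b) (E c) (E d) (phi_diff l)
  = spin_triple gam B x (spinor_diff l) b c d.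
Proof.
have triP := has_partial_trilin iy (frame_partial l b) (frame_partial l c)
  (frame_partial l d) (phi_partial l).
have spinP := has_partial_spin3 iy gam B b c d (spinor_partial l).
rewrite -(has_partialP spinP).
apply/esym/(has_partial_local iy open_overlap Uy _ triP).
by move=> z Uz _; exact: phi_spin.
Qed.

Definition cov_spinor l : 'cV[D]_8 :=
  cov gam x E (G i y) frame_diff christoffel_mx spinor_diff l.

Definition dirac_chi : 'cV[D]_8 :=
  \sum_b gam b *m \sum_l E b l *: cov_spinor l.

(** 8 = 4 * 48 / 24: four equal terms of the exterior derivative, 48 from [spin4_dphi], and 4! from
    the contraction of four-forms. The sign is that of [psi] against [spin4]. *)
Lemma ext_deriv_density : top_coef (wedge (ext_deriv phi i y) (phi i y)) =
  - (8%:R * s i y * bform B x dirac_chi).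
Proof.
have EGE := frame_EGE Uy.
have chi1 := chi_unit chi_spinor Uy.
transitivity (s i y * (\det E * top_coef (wedge (ext_deriv phi i y) (phi i y)))).
  by rewrite mulrA (frame_oriented Uy.1 Uy.2) mul1r.
rewrite -top_wedge43_pull top_wedge43_star.
rewrite -(psi_frame_star phi Uy) (psi_frame_alt chi_spinor Uy).
have altX := spin4_alternating nat_unit gam_cl B_sym B_inv chi1.
have := pull_alt_deriv E (fun l f => partial_dual i l (fun z => phi i z f) y) altX.
rewrite -[alt_deriv _]/(ext_deriv phi i y) => pullE.
under eq_bigr do rewrite mulrN.
rewrite sumrN pullE.
under eq_bigr do under eq_bigr do under eq_bigr do under eq_bigr do rewrite !tnth4E.
rewrite (_ : \sum_m _ = 48%:R * bform B x dirac_chi); last first.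
  rewrite /dirac_chi bform_sumr.
  exact: (spin4_dphi nat_unit gam_cl B_sym B_inv chi1 EGE christoffel_sym
    metric_compat frame_metric_diff (G_symmetric iy)
    (fun b c d => phi_spin b c d Uy) phi_diff_spin).
have scalars (c d b : D) : 24%:R * c = 1 ->
    d * (c * - (4%:R * (48%:R * b))) = - (8%:R * d * b).
  move=> c24; transitivity (- (24%:R * c) * (8%:R * d * b)); first by ring.
  by rewrite c24 mulN1r.
by apply: scalars; exact: mulrV (nat_unit 23).
Qed.

Lemma nabla_spinorE l : nabla_spinor p i l (chi p) y = cov_spinor l.
Proof.
have connE b c : gpair (G i y) (nabla_frame p i y l b) (row c E) =
    frame_conn E (G i y) frame_diff christoffel_mx l b c.
  rewrite /gpair /frame_conn.
  transitivity ((row b (frame_diff l + E *m (christoffel_mx l)^T) *m G i y *m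
    (row c E)^T) 0 0).
    rewrite (_ : nabla_frame p i y l b =
      row b (frame_diff l + E *m (christoffel_mx l)^T)) //.
    apply/matrixP => z k; rewrite !mxE; congr (_ + _).
    by apply: eq_bigr => j _; rewrite !mxE mulrC.
  move: (frame_diff l + _) => Q; rewrite -row_mul [LHS]mxE [RHS]mxE.
  by apply: eq_bigr => k _; rewrite [row b _ _ _]mxE !mxE.
rewrite /nabla_spinor.
under eq_bigr do under eq_bigr do rewrite connE.
by [].
Qed.

Lemma bform_dirac_scale (e : Y -> D) :
  (forall l, exists de, has_partial i y l e de) ->
  bform B x (dirac p i (fun z => e z *: chi p z) y) = e y * bform B x dirac_chi.
Proof.
move=> eP.
have nablaE l : nabla_spinor p i l (fun z => e z *: chi p z) y =
    partial_dual i l e y *: x + e y *: cov_spinor l.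
  have [de deP] := eP l; rewrite -nabla_spinorE (has_partialP deP).
  rewrite /nabla_spinor scalerDr addrA -scalemxAr.
  move: (_ *m x) => conn; apply: (congr1 (fun u => u + _)).
  apply/matrixP => m o; rewrite (ord1 o) !mxE.
  rewrite (_ : (fun z => (e z *: chi p z) m 0) = fun z => e z * chi p z m 0);
    last by apply/funext => z; rewrite mxE.
  by rewrite (has_partialP (has_partialM iy deP (spinor_partial l m 0))) mxE.
rewrite /dirac; under [X in bform _ _ X]eq_bigr do under eq_bigr do rewrite nablaE.
rewrite /dirac_chi; move: cov_spinor => n.
rewrite !bform_sumr mulr_sumr; apply: eq_bigr => b _.
rewrite mulmx_sumr !bform_sumr mulr_sumr; apply: eq_bigr => l _.
by apply: bform_orth_combination; exact: (bform_gam1 nat_unit gam_cl B_sym B_inv).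
Qed.
End PointwiseDerivative.

Lemma bform_scale2 (A : comUnitRingType) (B C : 'M[A]_8) (x : 'cV[A]_8) (e : A) :
  B^T = B -> bform B (e *: x) (C *m (e *: x)) = e * e * bform B x (C *m x).
Proof. by move=> B_sym; rewrite bformZl // -scalemxAr bformZr mulrA. Qed.

(** The two factors e^(-Phi) in the bilinears combine to e^(-2 Phi), and (1/4) * (1/2) * 8 = 1
    matches the Dirac term. The patch picked by [patch_at] is harmless, as the right side involves
    no frame. *)
Lemma ext_densityE (R : realType) (Y : topologicalType) (M : manifold7 R Y)
    (S : spinor_module R) (Phi : Y -> dual R) (H phi : form_field M 3)
    (G : chart M -> Y -> 'M[dual R]_7) (s : chart M -> Y -> dual R)
    (P : spin_structure S G s) (chi : spinor_field P)
    (psi := fun i y => hodge3 (G i y) (s i y) (phi i y)) i y :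
  smooth_dual M setT Phi -> is_form_field phi -> determines_metric phi G s ->
  determines_spinor phi psi chi -> Defs.dom i y ->
  ext_density H (fun p y => dual_exp (- Phi y) *: chi p y) i y * s i y =
  dual_const 4%:R^-1 * (dual_exp (- (2%:R * Phi y)) *
    (top_coef (wedge (H i y) (psi i y))
     - 2%:R^-1 * top_coef (wedge (ext_deriv phi i y) (phi i y)))).
Proof.
move=> smooth_Phi phi_field G_metric chi_spinor iy; rewrite /ext_density.
set p := patch_at P y; set e := fun z => dual_exp (- Phi z).
have Uy : (pdom p `&` Defs.dom i) y by split; [exact: (svalP (cid (pdom_cover P y)))|].
have eP l : exists de, has_partial i y l e de.
  have PhiP := smooth_dual_partial iy l I smooth_Phi.
  have [d dP] := has_partial_exp iy (has_partialM iy (has_partial_cst i y l (- 1)) PhiP).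
  by exists d; rewrite /e; under eq_fun do rewrite -mulN1r.
rewrite !spinor_pairE bform_scale2; last exact: dual_pairing_sym.
rewrite bformZl; last exact: dual_pairing_sym.
rewrite (bform_dirac_scale chi_spinor Uy eP).
rewrite (ext_deriv_density phi_field G_metric chi_spinor Uy).
rewrite (flux_density H chi_spinor Uy).
rewrite -/(e y) (_ : dual_exp (- (2%:R * Phi y)) = e y * e y); last first.
  by rewrite /e -dual_expD; congr dual_exp; ring.
have u4 := mulrV (dual_nat_unit R 3); have u2 := mulrV (dual_nat_unit R 1).
have -> : dual_const 4%:R^-1 = 4%:R^-1 :> dual R.
  by rewrite rmorphV ?rmorph_nat // unitfE pnatr_eq0.
have scalars (c h u t b q : dual R) : 4%:R * c = 1 -> 2%:R * h = 1 ->
    (u * (u * b) + c * (u * u * q)) * t =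
    c * (u * u * (t * q - h * - (8%:R * t * b))).
  move=> c4 h2; transitivity (u * u * t * (c * q + (4%:R * c) * (2%:R * h) * b)).
    by rewrite c4 h2; ring.
  by ring.
exact: scalars.
Qed.

(** * Scaling of integrals *)

(** For nonzero [c] both sequences converge or both diverge; in the latter case [limn] takes its
    default value 0, which scaling preserves. *)
Lemma limn_scale (R : realType) (c : R) (u : nat -> R) : c != 0 ->
  limn (fun n => c * u n) = c * limn u.
Proof.
move=> c0; have [cu|ncu] := pselect (cvgn u); first exact: limZl_tmp.
have ncv : ~ cvgn (fun n => c * u n).
  move=> cv; apply: ncu; rewrite (_ : u = fun n => c^-1 * (c * u n)).
    exact: is_cvgZl_tmp.
  by apply/funext => n; rewrite mulKf.
by rewrite (dvgP ncu) (dvgP ncv) [point in RHS](_ : _ = 0) ?mulr0.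
Qed.

Section Scale.
Local Open Scope ereal_scope.
Context d (T : measurableType d) (R : realType) (mu : {measure set T -> \bar R}).
Import HBNNSimple.

Let ge0_scale_le (c : R) (f : T -> \bar R) : (0 < c)%R -> (forall x, 0 <= f x) ->
  c%:E * \int[mu]_x f x <= \int[mu]_x (c%:E * f x).
Proof.
move=> c0 f0; rewrite -lee_pdivlMl//.
rewrite ge0_integralTE// ge0_integralTE; last first.
  by move=> x; rewrite mule_ge0// lee_fin ltW.
apply: ge_ereal_sup => _ [h /= hf <-]; rewrite lee_pdivlMl// -sintegralrM.
rewrite (_ : (_ \* _)%R = scale_nnsfun h (ltW c0)) //.
apply: ereal_sup_ubound; exists (scale_nnsfun h (ltW c0)) => // x /=.
by rewrite EFinM lee_pmul2l.
Qed.

(** The integral of a nonnegative function is a supremum over simple functions below it, and scaling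
    by [c] maps such functions for [f] to those for the multiple. This gives one inequality, its use
    with the inverse of [c] the other, and positive and negative parts the general case, with no
    appeal to measurability of [f]. *)
Lemma integral_scale (c : R) (f : T -> \bar R) : (0 < c)%R ->
  \int[mu]_x (c%:E * f x) = c%:E * \int[mu]_x f x.
Proof.
have ge0_scale k g : (0 < k)%R -> (forall x, 0 <= g x) ->
    \int[mu]_x (k%:E * g x) = k%:E * \int[mu]_x g x.
  move=> k0 g0; apply/eqP; rewrite eq_le ge0_scale_le// andbT.
  rewrite -lee_pdivrMl//; apply: (le_trans (ge0_scale_le _ _)).
  - by rewrite invr_gt0.
  - by move=> x; rewrite mule_ge0// lee_fin ltW.
  rewrite le_eqVlt; apply/orP; left; apply/eqP; apply: eq_integral => x _.
  by rewrite muleA -EFinM mulVf ?mul1e// gt_eqF.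
move=> c0; rewrite integralE [in RHS]integralE.
rewrite (_ : (fun x => _)^\+ = fun x => c%:E * f^\+ x); last first.
  by rewrite ge0_funeposM ?ltW.
rewrite (_ : (fun x => _)^\- = fun x => c%:E * f^\- x); last first.
  by rewrite ge0_funenegM ?ltW.
rewrite !ge0_scale//.
move: (integral _ _ _) (integral _ _ _) => [x||] [y||] //=;
  by rewrite -?EFinN -?EFinD -?EFinM ?mulrBr ?gt0_muley ?gt0_muleNy ?lte_fin.
Qed.
End Scale.

Lemma Rintegral_scale d (T : measurableType d) (R : realType)
    (mu : {measure set T -> \bar R}) (c : R) (f : T -> R) : 0 < c ->
  Rintegral mu setT (fun x => c * f x) = c * Rintegral mu setT f.
Proof.
move=> c0; rewrite /Rintegral.
under eq_integral do rewrite EFinM.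
rewrite (integral_scale _ (fun x => (f x)%:E))//.
(* [Rintegral] sends an infinite integral to 0, and multiplication by a positive [c] keeps it
   infinite. *)
by case: (integral _ _ _) => [x||] //=; rewrite ?gt0_muley ?gt0_muleNy ?lte_fin//= mulr0.
Qed.

Lemma iterated_integral_scale (R : realType) (c : R) n (f : 'rV[R]_n -> R) :
  0 < c -> iterated_integral (fun x => c * f x) = c * iterated_integral f.
Proof.
move=> c0; elim: n f => [|n IHn] f //=.
under eq_fun do rewrite IHn.
exact: Rintegral_scale.
Qed.

(** A constant without eps-part acts on both components separately, so one argument serves with [h]
    either projection. Agreement over chart domains suffices, because the integrand is set to 0
    outside the chart image. *)
Lemma integral7_scale (R : realType) (Y : topologicalType) (M : manifold7 R Y)
    (s : chart M -> Y -> dual R) (rh : partition_of_unity M) (c : R)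
    (w w' : chart M -> Y -> dual R) : 0 < c ->
  (forall i y, dom i y -> w i y = dual_const c * w' i y) ->
  integral7 s rh w = dual_const c * integral7 s rh w'.
Proof.
move=> c0 ww'.
have scale (h : dual R -> R) n : (forall x, h (dual_const c * x) = c * h x) ->
    chart_integral s rh n (h \o w (pchart rh n)) =
    c * chart_integral s rh n (h \o w' (pchart rh n)).
  move=> hc; rewrite /chart_integral -(@iterated_integral_scale R c 7 _ c0).
  apply: (congr1 (@iterated_integral R 7)); apply/funext => x; rewrite /patch.
  case: ifPn => [|_]; last by rewrite mulr0.
  rewrite inE => -[y iy <-]; by rewrite coordK//= ww'// hc mulrCA.
have scale_lim (h : dual R -> R) : (forall x, h (dual_const c * x) = c * h x) ->
    limn (series (fun n => chart_integral s rh n (h \o w (pchart rh n)))) =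
    c * limn (series (fun n => chart_integral s rh n (h \o w' (pchart rh n)))).
  move=> hc; rewrite -limn_scale ?gt_eqF//; congr (limn _); apply/funext => n.
  by rewrite /series /= mulr_sumr; apply: eq_bigr => k _; exact: scale.
by apply: dual_eq; rewrite /= ?mul0r ?addr0; apply: scale_lim => x /=;
  rewrite ?mul0r ?addr0.
Qed.

Theorem proposition4p2 (R : realType) (Y : topologicalType)
    (M : manifold7 R Y) (S : spinor_module R)
    (Phi : Y -> dual R) (H phi : form_field M 3)
    (G : chart M -> Y -> 'M[dual R]_7) (s : chart M -> Y -> dual R)
    (P : spin_structure S G s) (chi : spinor_field P)
    (rh : partition_of_unity M) :
  let psi : form_field M 4 := fun i y => hodge3 (G i y) (s i y) (phi i y) in
  smooth_dual M setT Phi ->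
  is_form_field H ->
  is_form_field phi ->
  positive_reduction phi ->
  determines_metric phi G s ->
  determines_spinor phi psi chi ->
  Wext rh Phi H chi =
  4%:R^-1 * integral7 s rh (fun i y =>
    dual_exp (- (2%:R * Phi y)) *
    (top_coef (wedge (H i y) (psi i y))
     - 2%:R^-1 * top_coef (wedge (ext_deriv phi i y) (phi i y)))).
Proof.
move=> psi smooth_Phi _ phi_field _ G_metric chi_spinor; rewrite /Wext.
have -> : 4%:R^-1 = dual_const 4%:R^-1 :> dual R.
  by rewrite rmorphV ?rmorph_nat // unitfE pnatr_eq0.
apply: integral7_scale => [|i y iy]; first by rewrite invr_gt0 ltr0n.
exact: ext_densityE.
Qed.
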